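(* Let $k$ be an algebraically closed field of characteristic $2$, and let $A=kD_8$ be the group algebra of the dihedral group of order $8$, i.e. $A=k\langle\alpha,\beta\rangle/(\alpha^2,\ \beta^2,\ (\alpha\beta)^2-(\beta\alpha)^2)$. Let $S$ be the unique simple $A$-module, and let $X$ be one of the two indecomposable direct summands of $\mathrm{rad}A/\mathrm{rad}^4A$. Put $\Lambda=\mathrm{End}_A(A\oplus S)^{op}$ and $\Gamma=\mathrm{End}_A(A\oplus X)^{op}$. Then the stable centers of the trivial extension algebras $T(\Lambda)$ and $T(\Gamma)$ are not isomorphic as algebras. In particular, $T(\Lambda)$ and $T(\Gamma)$ are not stably equivalent of Morita type.
   Context: Modules are finite dimensional left modules. The algebra $A$ is an $8$-dimensional local symmetric algebra, and $\mathrm{rad}A/\mathrm{rad}^4A$ (where $\mathrm{rad}^4A$ is the fourth power of the Jacobson radical, which is the socle of $A$) is the direct sum of two uniserial $A$-modules of length $3$, generated by the classes of $\alpha$ and of $\beta$ respectively; $X$ is either one of these. For a finite dimensional $k$-algebra $C$, let $D(C)=\mathrm{Hom}_k(C,k)$ with its natural $C$-$C$-bimodule structure. The trivial extension algebra $T(C)=C\ltimes D(C)$ is the $k$-vector space $C\oplus D(C)$ with multiplication $(a,f)(b,g)=(ab,\,ag+fb)$. Let $C^e=C\otimes_k C^{op}$, so that $C$-$C$-bimodules are left $C^e$-modules. The algebra $\mathrm{End}_{C^e}(C)$ is identified with the center $Z(C)$ via $f\mapsto f(1)$. The projective center $Z^{pr}(C)$ is the ideal of $Z(C)$ consisting of the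 $C^e$-homomorphisms $C\to C$ which factor through a projective $C^e$-module. The stable center of $C$ is the quotient algebra $Z^{st}(C)=Z(C)/Z^{pr}(C)$. Two finite dimensional $k$-algebras $C$ and $C'$ are stably equivalent of Morita type if there are bimodules ${}_CM_{C'}$ and ${}_{C'}N_C$, each projective as a left module and as a right module, such that there are bimodule isomorphisms $M\otimes_{C'}N\simeq C\oplus P$ and $N\otimes_C M\simeq C'\oplus Q$, where $P$ is a projective $C$-$C$-bimodule and $Q$ is a projective $C'$-$C'$-bimodule. *)

(* Defs.v *)
From HB Require Import structures.
From mathcomp Require Import all_boot all_order all_algebra all_field.
From mathcomp Require Import boolp.

Set Implicit Arguments.
Unset Strict Implicit.
Unset Printing Implicit Defensive.

Import GRing.Theory.
Local Open Scope ring_scope.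

Section LinearAlgebra.
Variable k : fieldType.

Section Subspaces.
Variable V : vectType k.

Definition lin_closed (P : V -> Prop) : Prop :=
  P 0 /\ forall a u v, P u -> P v -> P (a *: u + v).

Lemma vspace_of_exists (P : V -> Prop) :
  lin_closed P -> exists U : {vspace V}, forall x, x \in U <-> P x.
Proof.
move=> [P0 PD].
pose Q n := `[< exists U : {vspace V}, \dim U = n /\ forall x, x \in U -> P x >].
have exQ : exists n, Q n.
  exists 0%N; apply/asboolP; exists 0%VS; rewrite dimv0; split=> // x.
  by rewrite memv0 => /eqP->.
have ubQ n : Q n -> (n <= \dim {:V})%N.
  by move=> /asboolP[U [<- _]]; apply/dimvS/subvf.
case: (ex_maxnP exQ ubQ) => n /asboolP[U [dimU UP]] maxn.
exists U => x; split=> [/UP//|Px].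
have: Q (\dim (U + <[x]>)).
  apply/asboolP; exists (U + <[x]>)%VS; split=> // y.
  by move=> /memv_addP[u Uu [_ /vlineP[a ->] ->]]; rewrite addrC; apply/PD/UP.
move=> /maxn; rewrite -dimU => le_dim.
suff <- : (U + <[x]>)%VS = U by apply: (subvP (addvSr _ _)); apply: memv_line.
by apply/esym/eqP; rewrite eqEdim addvSl.
Qed.

Definition vspace_of (P : V -> Prop) (clP : lin_closed P) : {vspace V} :=
  projT1 (cid (vspace_of_exists clP)).

Lemma mem_vspace_of P (clP : lin_closed P) x : x \in vspace_of clP <-> P x.
Proof. exact: projT2 (cid (vspace_of_exists clP)) x. Qed.

Definition in_span (S : V -> Prop) (x : V) : Prop :=
  forall U : {vspace V}, (forall y, S y -> y \in U) -> x \in U.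

Lemma in_span_closed S : lin_closed (in_span S).
Proof.
by split=> [|a u v Su Sv] U SU; rewrite (mem0v, memvD) ?memvZ ?Su ?Sv.
Qed.

(* The library's [span] is restricted to finite families. *)
Definition vspan (S : V -> Prop) : {vspace V} := vspace_of (in_span_closed S).

Lemma mem_vspan S y : S y -> y \in vspan S.
Proof. by move=> Sy; apply/mem_vspace_of => U; apply. Qed.

Lemma vspan_min S (U : {vspace V}) :
  (forall y, S y -> y \in U) -> (vspan S <= U)%VS.
Proof. by move=> SU; apply/subvP=> x /mem_vspace_of; apply. Qed.

End Subspaces.

Section Quotient.
Variables (V : vectType k) (U : {vspace V}).

(* V / U, realised on the chosen complement U^C so that it is a vectType;
   only the projection quot_pi, onto with kernel U, is meant to be used. *)
Definition quotvs : Type := subvs_of (U^C)%VS.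
HB.instance Definition _ := Vector.on quotvs.

Definition quot_repr (x : quotvs) : V := vsval (x : subvs_of (U^C)%VS).
Definition quot_pi (v : V) : quotvs := vsproj (U^C)%VS (daddv_pi (U^C)%VS U v).

Fact quot_repr_linear : linear quot_repr. Proof. by []. Qed.
HB.instance Definition _ :=
  GRing.isLinear.Build k quotvs V *:%R quot_repr quot_repr_linear.

Fact quot_pi_linear : linear quot_pi.
Proof. by move=> a u v; rewrite /quot_pi !linearP. Qed.
HB.instance Definition _ :=
  GRing.isLinear.Build k V quotvs *:%R quot_pi quot_pi_linear.

Lemma quot_cap : (U^C :&: U = 0)%VS. Proof. by rewrite capvC capv_compl. Qed.

Lemma quot_reprK : cancel quot_repr quot_pi.
Proof.
move=> x; rewrite /quot_pi daddv_pi_id ?quot_cap ?subvsP //; exact: vsvalK.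
Qed.

Lemma quot_piK v : quot_repr (quot_pi v) - v \in U.
Proof.
rewrite /quot_repr /quot_pi vsprojK ?memv_pi //.
have E : daddv_pi (U^C)%VS U v + daddv_pi U (U^C)%VS v = v.
  by apply: daddv_pi_add; rewrite ?quot_cap // addvC addv_complf memvf.
by rewrite -[X in _ - X]E opprD addNKr memvN memv_pi.
Qed.

Lemma quot_pi_eq0 v : (quot_pi v == 0) = (v \in U).
Proof.
apply/eqP/idP=> [pv0|Uv].
  by have:= quot_piK v; rewrite pv0 linear0 sub0r memvN.
apply: val_inj; rewrite /= /quot_pi vsprojK ?memv_pi //.
apply/eqP; rewrite -memv0 -quot_cap memv_cap memv_pi /=.
rewrite -[X in X \in U](subrK v) memvD //.
by have := quot_piK v; rewrite /quot_repr /quot_pi vsprojK ?memv_pi.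
Qed.

Lemma quot_pi_eq u v : (quot_pi u == quot_pi v) = (u - v \in U).
Proof. by rewrite -subr_eq0 -linearB quot_pi_eq0. Qed.

End Quotient.
End LinearAlgebra.

Section ConverseAlgebra.
Variables (k : fieldType) (D : falgType k).

HB.instance Definition _ := Vector.copy D^c D.

Fact conv_scaleAl (a : k) (x y : D^c) : a *: (x * y) = (a *: x : D^c) * y.
Proof. exact: (@scalerAr _ D a y x). Qed.
HB.instance Definition _ := GRing.Lmodule_isLalgebra.Build k D^c conv_scaleAl.

Fact conv_scaleAr (a : k) (x y : D^c) : a *: (x * y) = x * (a *: y : D^c).
Proof. exact: (@scalerAl _ D a y x). Qed.
HB.instance Definition _ := GRing.Lalgebra_isAlgebra.Build k D^c conv_scaleAr.

End ConverseAlgebra.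

Section Modules.
Variables (k : fieldType) (C : falgType k).

(* Finite dimensional left C-modules. *)
Record lmodule := LModule {
  lmod_sort :> vectType k;
  lact : C -> lmod_sort -> lmod_sort;
  lact_linearl : forall x, linear (fun a => lact a x);
  lact_linearr : forall a, linear (lact a);
  lact1 : forall x, lact 1 x = x;
  lactM : forall a b x, lact (a * b) x = lact a (lact b x)
}.

Definition lmod_hom (M N : lmodule) (f : 'Hom(M, N)) : Prop :=
  forall a x, f (lact a x) = lact a (f x).

Definition lmod_iso (M N : lmodule) : Prop :=
  exists2 f : 'Hom(M, N), lmod_hom f & bijective f.

Definition lmod_projective (P : lmodule) : Prop :=
  forall (M N : lmodule) (g : 'Hom(M, N)) (f : 'Hom(P, N)),
    lmod_hom g -> (forall y, exists x, g x = y) -> lmod_hom f ->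
  exists2 h : 'Hom(P, M), lmod_hom h & forall x, g (h x) = f x.

Definition submodule (M : lmodule) (U : {vspace M}) : Prop :=
  forall a x, x \in U -> lact a x \in U.

Definition simple_module (M : lmodule) : Prop :=
  fullv != 0%VS :> {vspace M} /\
  forall U : {vspace M}, submodule U -> U = 0%VS \/ U = fullv.

Definition indecomposable_module (M : lmodule) : Prop :=
  fullv != 0%VS :> {vspace M} /\
  forall U V : {vspace M}, submodule U -> submodule V ->
    (U + V)%VS = fullv -> (U :&: V)%VS = 0%VS -> U = 0%VS \/ V = 0%VS.

Section RegularModule.
Fact reg_linearl (x : C) : linear (fun a : C => a * x).
Proof. by move=> c a b; rewrite mulrDl scalerAl. Qed.
Fact reg_linearr (a : C) : linear (fun x : C => a * x).
Proof. by move=> c x y; rewrite mulrDr scalerAr. Qed.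

Definition reg_lmodule : lmodule :=
  @LModule C (fun a x : C => a * x) reg_linearl reg_linearr
    (@mul1r C) (fun a b x => esym (mulrA a b x)).
End RegularModule.

Section DirectSum.
Variables M N : lmodule.
Definition dsum_act (a : C) (x : M * N) : M * N := (lact a x.1, lact a x.2).
Fact dsum_linearl x : linear (fun a => dsum_act a x).
Proof.
move=> c a b; rewrite /dsum_act.
by rewrite (lact_linearl x.1) (lact_linearl x.2).
Qed.
Fact dsum_linearr a : linear (dsum_act a).
Proof. by move=> c x y; rewrite /dsum_act /= !lact_linearr. Qed.
Fact dsum_act1 x : dsum_act 1 x = x.
Proof. by case: x => x y; rewrite /dsum_act !lact1. Qed.
Fact dsum_actM a b x : dsum_act (a * b) x = dsum_act a (dsum_act b x).
Proof. by rewrite /dsum_act /= !lactM. Qed.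
Definition dsum_lmodule : lmodule :=
  @LModule (M * N)%type dsum_act
    dsum_linearl dsum_linearr dsum_act1 dsum_actM.
End DirectSum.

Section Submodule.
Variables (M : lmodule) (U : {vspace M}) (subU : submodule U).
Definition sub_act (a : C) (x : subvs_of U) : subvs_of U :=
  vsproj U (lact a (vsval x)).
Lemma sub_actE a x : vsval (sub_act a x) = lact a (vsval x).
Proof. by rewrite vsprojK ?subU ?subvsP. Qed.
Fact sub_linearl x : linear (fun a => sub_act a x).
Proof.
by move=> c a b; apply: val_inj; rewrite /= !sub_actE lact_linearl.
Qed.
Fact sub_linearr a : linear (sub_act a).
Proof.
by move=> c x y; apply: val_inj; rewrite /= !sub_actE lact_linearr.
Qed.
Fact sub_act1 x : sub_act 1 x = x.
Proof. by apply: val_inj; rewrite /= sub_actE lact1. Qed.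
Fact sub_actM a b x : sub_act (a * b) x = sub_act a (sub_act b x).
Proof. by apply: val_inj; rewrite /= !sub_actE lactM. Qed.
Definition sub_lmodule : lmodule :=
  @LModule (subvs_of U) sub_act sub_linearl sub_linearr sub_act1 sub_actM.
End Submodule.

Section QuotientModule.
Variables (M : lmodule) (U : {vspace M}) (subU : submodule U).
Definition quot_act (a : C) (x : quotvs U) : quotvs U :=
  quot_pi U (lact a (quot_repr x)).
Lemma quot_actE a x : quot_act a (quot_pi U x) = quot_pi U (lact a x).
Proof.
apply/eqP; rewrite quot_pi_eq -scaleN1r addrC -lact_linearr.
by apply: subU; rewrite scaleN1r addrC quot_piK.
Qed.
Fact quot_linearl x : linear (fun a => quot_act a x).
Proof. by move=> c a b; rewrite /quot_act lact_linearl linearP. Qed.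
Fact quot_linearr a : linear (quot_act a).
Proof. by move=> c x y; rewrite /quot_act linearP lact_linearr linearP. Qed.
Fact quot_act1 x : quot_act 1 x = x.
Proof. by rewrite /quot_act lact1 quot_reprK. Qed.
Fact quot_actM a b x : quot_act (a * b) x = quot_act a (quot_act b x).
Proof. by rewrite {3}/quot_act quot_actE /quot_act lactM. Qed.
Definition quot_lmodule : lmodule :=
  @LModule (quotvs U) quot_act quot_linearl quot_linearr quot_act1 quot_actM.
End QuotientModule.

End Modules.

Section Radical.
Variables (k : fieldType) (A : falgType k).
Local Notation regA := (reg_lmodule A).

Definition maximal_left_ideal (L : {vspace A}) : Prop :=
  [/\ @submodule k A regA L, L != fullv
    & forall L' : {vspace A}, @submodule k A regA L' -> (L <= L')%VS ->
        L' = L \/ L' = fullv].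

Definition in_radical (x : A) : Prop :=
  forall L, maximal_left_ideal L -> x \in L.

Fact in_radical_closed : lin_closed in_radical.
Proof.
split=> [|a u v Ju Jv] L maxL; first exact: mem0v.
by rewrite memvD ?memvZ ?Ju ?Jv.
Qed.

Definition jacobson_radical : {vspace A} := vspace_of in_radical_closed.
Local Notation J := jacobson_radical.

Lemma radX_submodule n : @submodule k A regA (J ^+ n.+1)%VS.
Proof.
elim: n => [|n _] a x.
  rewrite expv1 => /mem_vspace_of Jx; apply/mem_vspace_of => L maxL.
  by have [subL _ _] := maxL; apply/subL/Jx.
have /subvP sub1 : (<[a]> * J ^+ n.+2 <= J ^+ n.+2)%VS.
  rewrite expvSl prodvA; apply: prodvSl; apply/prodvP=> b y.
  move=> /vlineP[c ->] /mem_vspace_of Jy; rewrite -scalerAl memvZ //.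
  apply/mem_vspace_of => L maxL.
  by have [subL _ _] := maxL; apply/(subL a)/Jy.
by move=> Jx; apply/sub1/memv_mul => //; apply: memv_line.
Qed.

Definition rad_module : lmodule A := sub_lmodule (@radX_submodule 0).

(* rad^4 A as a subspace of rad A. *)
Definition rad4_in_rad : {vspace rad_module} :=
  (linfun (vsval : rad_module -> A) @^-1: (J ^+ 4))%VS.

Fact rad4_in_rad_submodule : submodule rad4_in_rad.
Proof.
move=> a x; rewrite -!memv_preim !lfunE /= => Jx.
rewrite (sub_actE (@radX_submodule 0) a x); exact: radX_submodule Jx.
Qed.

Definition rad_mod_rad4 : lmodule A := quot_lmodule rad4_in_rad_submodule.

End Radical.

Section EndomorphismAlgebra.
Variables (k : fieldType) (C : falgType k) (M : lmodule C).

Fact lmod_hom_closed : lin_closed (@lmod_hom k C M M).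
Proof.
split=> [|c f g homf homg] a x.
  have := lact_linearr a (-1) (0 : M) 0.
  by rewrite !lfunE /= scaler0 addr0 scaleN1r addNr.
by rewrite !(add_lfunE, scale_lfunE) homf homg lact_linearr.
Qed.

Definition endo_vs : {vspace 'End(M)} := vspace_of lmod_hom_closed.

(* End_C(M)^op: the product of f and g is g \o f.  The algebras of the library
   are nonzero, hence the condition on M. *)
Definition endop (nzM : fullv != 0%VS :> {vspace M}) : Type := subvs_of endo_vs.

Variable nzM : fullv != 0%VS :> {vspace M}.
Local Notation E := (endop nzM).

HB.instance Definition _ := Vector.on E.

Definition endop_val (f : E) : 'End(M) := vsval (f : subvs_of endo_vs).
Definition endop_of (f : 'End(M)) : E := vsproj endo_vs f.

Definition endop_mul (f g : E) : E := endop_of (endop_val g \o endop_val f)%VF.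
Definition endop_one : E := endop_of \1%VF.

Lemma endop_hom (f : E) : lmod_hom (endop_val f).
Proof. exact/(mem_vspace_of lmod_hom_closed)/(subvsP f). Qed.

Lemma endop_ofK f : lmod_hom f -> endop_val (endop_of f) = f.
Proof. by move=> homf; apply/vsprojK/mem_vspace_of. Qed.

Lemma endop_val_inj : injective endop_val. Proof. exact: subvs_inj. Qed.

Lemma endop_mulE f g : endop_val (endop_mul f g) = (endop_val g \o endop_val f)%VF.
Proof. by apply: endop_ofK => a x; rewrite !comp_lfunE !endop_hom. Qed.

Lemma endop_oneE : endop_val endop_one = \1%VF.
Proof. by apply: endop_ofK => a x; rewrite !id_lfunE. Qed.

Lemma endop_valD f g : endop_val (f + g) = endop_val f + endop_val g.
Proof. by []. Qed.
Lemma endop_valZ (c : k) f : endop_val (c *: f) = c *: endop_val f.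
Proof. by []. Qed.

Fact endop_mulA : associative endop_mul.
Proof. by move=> f g h; apply: endop_val_inj; rewrite !endop_mulE comp_lfunA. Qed.
Fact endop_mul1 : left_id endop_one endop_mul.
Proof.
by move=> f; apply: endop_val_inj; rewrite endop_mulE endop_oneE comp_lfun1r.
Qed.
Fact endop_1mul : right_id endop_one endop_mul.
Proof.
by move=> f; apply: endop_val_inj; rewrite endop_mulE endop_oneE comp_lfun1l.
Qed.
Fact endop_mulDl : left_distributive endop_mul +%R.
Proof.
move=> f g h; apply: endop_val_inj.
by rewrite endop_valD !endop_mulE endop_valD comp_lfunDr.
Qed.
Fact endop_mulDr : right_distributive endop_mul +%R.
Proof.
move=> f g h; apply: endop_val_inj.
by rewrite endop_valD !endop_mulE endop_valD comp_lfunDl.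
Qed.
Fact endop_one_neq0 : endop_one != 0.
Proof.
apply: contraNneq nzM => one0; rewrite -subv0; apply/subvP=> x _.
by rewrite memv0 -[x]id_lfunE -endop_oneE one0 lfunE.
Qed.
HB.instance Definition _ := GRing.Zmodule_isNzRing.Build E
  endop_mulA endop_mul1 endop_1mul endop_mulDl endop_mulDr endop_one_neq0.

Lemma endop_valM (f g : E) :
  endop_val (f * g) = (endop_val g \o endop_val f)%VF.
Proof. exact: endop_mulE. Qed.

Fact endop_scaleAl (a : k) (f g : E) : a *: (f * g) = a *: f * g.
Proof.
apply: endop_val_inj.
by rewrite endop_valZ !endop_valM endop_valZ comp_lfunZr.
Qed.
HB.instance Definition _ := GRing.Lmodule_isLalgebra.Build k E endop_scaleAl.
Fact endop_scaleAr (a : k) (f g : E) : a *: (f * g) = f * (a *: g).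
Proof.
apply: endop_val_inj.
by rewrite endop_valZ !endop_valM endop_valZ comp_lfunZl.
Qed.
HB.instance Definition _ := GRing.Lalgebra_isAlgebra.Build k E endop_scaleAr.
HB.instance Definition _ := Algebra_isFalgebra.Build k E.

End EndomorphismAlgebra.

Section GeneratorEndomorphisms.
Variables (k : fieldType) (A : falgType k) (X : lmodule A).

Fact reg_dsum_neq0 :
  fullv != 0%VS :> {vspace dsum_lmodule (reg_lmodule A) X}.
Proof.
apply/eqP=> full0.
have : ((1 : A), (0 : X)) \in (fullv : {vspace dsum_lmodule (reg_lmodule A) X}).
  exact: memvf.
by rewrite full0 memv0 => /eqP[/eqP]; rewrite oner_eq0.
Qed.

(* End_A(A (+) X)^op *)
Definition reg_dsum_endop : falgType k := endop reg_dsum_neq0.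
End GeneratorEndomorphisms.

Section TrivialExtension.
Variables (k : fieldType) (C : falgType k).

(* The C-C-bimodule D(C) = Hom_k(C, k); see dual_lactE and dual_ractE. *)
Definition dual_lact (a : C) (f : 'Hom(C, k^o)) : 'Hom(C, k^o) :=
  (f \o amulr a)%VF.
Definition dual_ract (f : 'Hom(C, k^o)) (b : C) : 'Hom(C, k^o) :=
  (f \o amull b)%VF.

Lemma dual_lactE a f x : dual_lact a f x = f (x * a).
Proof. by rewrite comp_lfunE lfunE. Qed.
Lemma dual_ractE f b x : dual_ract f b x = f (b * x).
Proof. by rewrite comp_lfunE lfunE. Qed.

Definition trivext : Type := (C * 'Hom(C, k^o))%type.
HB.instance Definition _ := Vector.on trivext.

Definition trivext_mul (x y : trivext) : trivext :=
  (x.1 * y.1, dual_lact x.1 y.2 + dual_ract x.2 y.1).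
Definition trivext_one : trivext := (1, 0).

Fact trivext_mulA : associative trivext_mul.
Proof.
move=> [a f] [b g] [c h]; congr pair; rewrite /= ?mulrA //.
by apply/lfunP=> x; rewrite !(add_lfunE, dual_lactE, dual_ractE) /= !mulrA addrA.
Qed.
Fact trivext_mul1 : left_id trivext_one trivext_mul.
Proof.
move=> [a f]; congr pair; rewrite /= ?mul1r //.
by apply/lfunP=> x; rewrite !(add_lfunE, dual_lactE, dual_ractE) lfunE /= mulr1 addr0.
Qed.
Fact trivext_1mul : right_id trivext_one trivext_mul.
Proof.
move=> [a f]; congr pair; rewrite /= ?mulr1 //.
by apply/lfunP=> x; rewrite !(add_lfunE, dual_lactE, dual_ractE) lfunE /= mul1r add0r.
Qed.
Fact trivext_mulDl : left_distributive trivext_mul +%R.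
Proof.
move=> [a f] [b g] [c h]; congr pair; rewrite /= ?mulrDl //.
apply/lfunP=> x; rewrite !(add_lfunE, dual_lactE, dual_ractE) /=.
by rewrite mulrDr linearD /= addrACA.
Qed.
Fact trivext_mulDr : right_distributive trivext_mul +%R.
Proof.
move=> [a f] [b g] [c h]; congr pair; rewrite /= ?mulrDr //.
apply/lfunP=> x; rewrite !(add_lfunE, dual_lactE, dual_ractE) /=.
by rewrite mulrDl linearD /= addrACA.
Qed.
Fact trivext_one_neq0 : trivext_one != 0.
Proof. by apply/eqP=> -[/eqP]; rewrite oner_eq0. Qed.
HB.instance Definition _ := GRing.Zmodule_isNzRing.Build trivext
  trivext_mulA trivext_mul1 trivext_1mul trivext_mulDl trivext_mulDr
  trivext_one_neq0.

Fact trivext_scaleAl (c : k) (x y : trivext) : c *: (x * y) = c *: x * y.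
Proof.
case: x y => [a f] [b g]; congr pair; rewrite /= ?scalerAl //.
apply/lfunP=> x; rewrite !(add_lfunE, scale_lfunE, dual_lactE, dual_ractE) /=.
by rewrite -scalerAr linearZ /= scalerDr.
Qed.
HB.instance Definition _ :=
  GRing.Lmodule_isLalgebra.Build k trivext trivext_scaleAl.
Fact trivext_scaleAr (c : k) (x y : trivext) : c *: (x * y) = x * (c *: y).
Proof.
case: x y => [a f] [b g]; congr pair; rewrite /= ?scalerAr //.
apply/lfunP=> x; rewrite !(add_lfunE, scale_lfunE, dual_lactE, dual_ractE) /=.
by rewrite -scalerAl linearZ /= scalerDr.
Qed.
HB.instance Definition _ :=
  GRing.Lalgebra_isAlgebra.Build k trivext trivext_scaleAr.
HB.instance Definition _ := Algebra_isFalgebra.Build k trivext.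

End TrivialExtension.

Section Bimodules.
Variables (k : fieldType) (C D : falgType k).

(* Finite dimensional C-D-bimodules on which k acts centrally, i.e. left
   modules over C (x)_k D^op. *)
Record bimodule := Bimodule {
  bimod_sort :> vectType k;
  bl : C -> bimod_sort -> bimod_sort;
  br : bimod_sort -> D -> bimod_sort;
  bl_linearl : forall x, linear (fun a => bl a x);
  bl_linearr : forall a, linear (bl a);
  br_linearl : forall b, linear (fun x => br x b);
  br_linearr : forall x, linear (br x);
  bl1 : forall x, bl 1 x = x;
  blM : forall a b x, bl (a * b) x = bl a (bl b x);
  br1 : forall x, br x 1 = x;
  brM : forall a b x, br x (a * b) = br (br x a) b;
  blr : forall a x b, br (bl a x) b = bl a (br x b)
}.

Definition bimod_hom (M N : bimodule) (f : 'Hom(M, N)) : Prop :=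
  (forall a x, f (bl a x) = bl a (f x)) /\ (forall x b, f (br x b) = br (f x) b).

Definition bimod_iso (M N : bimodule) : Prop :=
  exists2 f : 'Hom(M, N), bimod_hom f & bijective f.

Definition bimod_projective (P : bimodule) : Prop :=
  forall (M N : bimodule) (g : 'Hom(M, N)) (f : 'Hom(P, N)),
    bimod_hom g -> (forall y, exists x, g x = y) -> bimod_hom f ->
  exists2 h : 'Hom(P, M), bimod_hom h & forall x, g (h x) = f x.

Definition left_module (M : bimodule) : lmodule C :=
  @LModule k C M (@bl M) (@bl_linearl M) (@bl_linearr M) (@bl1 M) (@blM M).

(* A right D-module is a left module over the converse algebra D^c. *)
Definition right_module (M : bimodule) : lmodule D^c :=
  @LModule k D^c M (fun (b : D^c) x => br x (b : D))
    (@br_linearr M) (@br_linearl M) (@br1 M) (fun a b x => @brM M b a x).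

Section BimoduleSum.
Variables M N : bimodule.
Definition bsum_bl (a : C) (x : M * N) : M * N := (bl a x.1, bl a x.2).
Definition bsum_br (x : M * N) (b : D) : M * N := (br x.1 b, br x.2 b).
Fact bsum_bl_linearl x : linear (fun a => bsum_bl a x).
Proof.
by move=> c a b; rewrite /bsum_bl (bl_linearl x.1) (bl_linearl x.2).
Qed.
Fact bsum_bl_linearr a : linear (bsum_bl a).
Proof. by move=> c x y; rewrite /bsum_bl /= !bl_linearr. Qed.
Fact bsum_br_linearl b : linear (fun x => bsum_br x b).
Proof.
move=> c x y; congr pair; [exact: (br_linearl b c x.1 y.1)|].
exact: (br_linearl b c x.2 y.2).
Qed.
Fact bsum_br_linearr x : linear (bsum_br x).
Proof. by move=> c a b; rewrite /bsum_br !br_linearr. Qed.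
Fact bsum_bl1 x : bsum_bl 1 x = x.
Proof. by case: x => x y; rewrite /bsum_bl !bl1. Qed.
Fact bsum_blM a b x : bsum_bl (a * b) x = bsum_bl a (bsum_bl b x).
Proof. by rewrite /bsum_bl /= !blM. Qed.
Fact bsum_br1 x : bsum_br x 1 = x.
Proof. by case: x => x y; rewrite /bsum_br !br1. Qed.
Fact bsum_brM a b x : bsum_br x (a * b) = bsum_br (bsum_br x a) b.
Proof. by rewrite /bsum_br /= !brM. Qed.
Fact bsum_blr a x b : bsum_br (bsum_bl a x) b = bsum_bl a (bsum_br x b).
Proof. by rewrite /bsum_bl /bsum_br /= !blr. Qed.
Definition dsum_bimodule : bimodule :=
  @Bimodule (M * N)%type bsum_bl bsum_br
    bsum_bl_linearl bsum_bl_linearr bsum_br_linearl bsum_br_linearr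
    bsum_bl1 bsum_blM bsum_br1 bsum_brM bsum_blr.
End BimoduleSum.

Lemma dsum_bimod_projective P Q :
  bimod_projective P -> bimod_projective Q ->
  bimod_projective (dsum_bimodule P Q).
Proof.
move=> projP projQ M N g f homg surjg [flin frin].
pose f1 : 'Hom(P, N) := linfun (fun x : P => f (x, 0)).
pose f2 : 'Hom(Q, N) := linfun (fun x : Q => f (0, x)).
have blin1 : linear (fun x : P => f (x, 0)).
  by move=> c x y; rewrite -linearP /=; congr (f (_, _)); rewrite /= scaler0 addr0.
have blin2 : linear (fun x : Q => f (0, x)).
  by move=> c x y; rewrite -linearP /=; congr (f (_, _)); rewrite /= scaler0 addr0.
have f1E x : f1 x = f (x, 0).
  pose L := GRing.isLinear.Build k P N *:%R _ blin1.
  pose F : {linear P -> N} := HB.pack (fun x : P => f (x, 0)) L.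
  exact: (lfunE F x).
have f2E x : f2 x = f (0, x).
  pose L := GRing.isLinear.Build k Q N *:%R _ blin2.
  pose F : {linear Q -> N} := HB.pack (fun x : Q => f (0, x)) L.
  exact: (lfunE F x).
have bl0 (T : bimodule) a : bl a (0 : T) = 0.
  by have := bl_linearr a (-1) (0 : T) 0; rewrite scaler0 addr0 scaleN1r addNr.
have br0 (T : bimodule) b : br (0 : T) b = 0.
  by have := br_linearl b (-1) (0 : T) 0; rewrite scaler0 addr0 scaleN1r addNr.
have homf1 : bimod_hom f1.
  split=> [a x | x b]; rewrite !f1E.
    by rewrite -flin /= /bsum_bl /= bl0.
  by rewrite -frin /= /bsum_br /= br0.
have homf2 : bimod_hom f2.
  split=> [a x | x b]; rewrite !f2E.
    by rewrite -flin /= /bsum_bl /= bl0.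
  by rewrite -frin /= /bsum_br /= br0.
have [h1 [h1l h1r] gh1] := projP _ _ _ _ homg surjg homf1.
have [h2 [h2l h2r] gh2] := projQ _ _ _ _ homg surjg homf2.
have hlin : linear (fun x : dsum_bimodule P Q => h1 x.1 + h2 x.2).
  by move=> c x y; rewrite /= !linearP /= scalerDr addrACA.
pose L := GRing.isLinear.Build k (dsum_bimodule P Q) M *:%R _ hlin.
pose F : {linear dsum_bimodule P Q -> M} :=
  HB.pack (fun x : dsum_bimodule P Q => h1 x.1 + h2 x.2) L.
have FE x : linfun F x = h1 x.1 + h2 x.2 by rewrite lfunE.
have blD (T : bimodule) a (x y : T) : bl a (x + y) = bl a x + bl a y.
  by have := bl_linearr a 1 x y; rewrite !scale1r.
have brD (T : bimodule) b (x y : T) : br (x + y) b = br x b + br y b.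
  by have := br_linearl b 1 x y; rewrite !scale1r.
exists (linfun F); first by split=> *; rewrite !FE /= ?h1l ?h2l ?h1r ?h2r ?blD ?brD.
move=> [x y]; rewrite FE /= linearD /= gh1 gh2 f1E f2E -linearD /=.
by congr (f (_, _)); rewrite ?addr0 ?add0r.
Qed.

End Bimodules.

Section RegularBimodule.
Variables (k : fieldType) (C : falgType k).

Fact regb_br_linearl (b : C) : linear (fun x : C => x * b).
Proof. by move=> c x y; rewrite mulrDl scalerAl. Qed.
Fact regb_br_linearr (x : C) : linear (fun b : C => x * b).
Proof. by move=> c a b; rewrite mulrDr scalerAr. Qed.

Definition reg_bimodule : bimodule C C :=
  @Bimodule k C C C (fun a x => a * x) (fun x b => x * b)
    (@reg_linearl k C) (@reg_linearr k C) regb_br_linearl regb_br_linearr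
    (@mul1r C) (fun a b x => esym (mulrA a b x))
    (@mulr1 C) (fun a b x => mulrA x a b) (fun a x b => esym (mulrA a x b)).

End RegularBimodule.

Section StableCenter.
Variables (k : fieldType) (C : falgType k).
Local Notation regC := (reg_bimodule C).

Definition center : falgType k := subvs_of 'Z({:C})%AS.

Definition factors_through_projective (f : 'Hom(regC, regC)) : Prop :=
  exists2 P : bimodule C C, bimod_projective P &
  exists g : 'Hom(regC, P), exists h : 'Hom(P, regC),
    [/\ bimod_hom g, bimod_hom h & f = (h \o g)%VF].

Definition in_proj_center (z : center) : Prop :=
  exists f : 'Hom(regC, regC),
    [/\ bimod_hom f, factors_through_projective f & f 1 = vsval z].

Lemma bimod_hom_comp (M N P : bimodule C C) (g : 'Hom(N, P)) (f : 'Hom(M, N)) :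
  bimod_hom g -> bimod_hom f -> bimod_hom (g \o f)%VF.
Proof.
by move=> [gl gr] [fl fr]; split=> *; rewrite !comp_lfunE ?fl ?fr ?gl ?gr.
Qed.

Lemma centerC (z : center) (x : C) : vsval z * x = x * vsval z.
Proof.
have /= := subvsP z; rewrite memv_cap => /andP[_ /centvP cz].
by apply: cz; apply: memvf.
Qed.

Definition zero_bimodule : bimodule C C.
Proof.
by refine (@Bimodule k C C 'rV[k]_0 (fun _ x => x) (fun x _ => x)
  _ _ _ _ _ _ _ _ _) => // ? ? ? ?; rewrite [LHS]thinmx0 [RHS]thinmx0.
Defined.

Lemma zero_bimodule_projective : bimod_projective zero_bimodule.
Proof.
move=> M N g f [gl gr] surjg homf.
have x0 (x : zero_bimodule) : x = 0 by exact: thinmx0.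
have bl0 (T : bimodule C C) a : bl a (0 : T) = 0.
  by have := bl_linearr a (-1) (0 : T) 0; rewrite scaler0 addr0 scaleN1r addNr.
have br0 (T : bimodule C C) b : br (0 : T) b = 0.
  by have := br_linearl b (-1) (0 : T) 0; rewrite scaler0 addr0 scaleN1r addNr.
exists 0; first by split=> *; rewrite !lfunE /= ?bl0 ?br0.
by move=> x; rewrite (x0 x) !linear0.
Qed.

Fact in_proj_center_closed : lin_closed in_proj_center.
Proof.
split=> [|c y z].
  exists 0; split; first by split=> *; rewrite !lfunE /= ?mulr0 ?mul0r.
    exists zero_bimodule; first exact: zero_bimodule_projective.
    exists 0, 0; split; last by apply/lfunP=> x; rewrite comp_lfunE !lfunE.
      by split=> *; rewrite !lfunE //=.
    by split=> *; rewrite !lfunE /= ?mulr0 ?mul0r.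
  by rewrite lfunE.
move=> [f1 [[l1 r1] [P1 proj1 [g1 [h1 [[gl1 gr1] [hl1 hr1] E1]]]] y1]].
move=> [f2 [[l2 r2] [P2 proj2 [g2 [h2 [[gl2 gr2] [hl2 hr2] E2]]]] z1]].
exists (c *: f1 + f2); split; last by rewrite !(add_lfunE, scale_lfunE) y1 z1.
  split=> [a x | x b]; rewrite !(add_lfunE, scale_lfunE).
    by rewrite l1 l2 /= mulrDr scalerAr.
  by rewrite r1 r2 /= mulrDl scalerAl.
exists (dsum_bimodule P1 P2); first exact: dsum_bimod_projective.
have glin : linear (fun x : regC => (g1 x, g2 x) : dsum_bimodule P1 P2).
  by move=> b u v; rewrite !linearP.
have hlin : linear (fun x : dsum_bimodule P1 P2 => c *: h1 x.1 + h2 x.2).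
  move=> b u v; rewrite /= (linearP h1) (linearP h2) !scalerDr !scalerA [c * b]mulrC.
  by rewrite addrACA.
pose G : {linear regC -> dsum_bimodule P1 P2} :=
  HB.pack (fun x : regC => (g1 x, g2 x) : dsum_bimodule P1 P2)
    (GRing.isLinear.Build k regC (dsum_bimodule P1 P2) *:%R _ glin).
pose H : {linear dsum_bimodule P1 P2 -> regC} :=
  HB.pack (fun x : dsum_bimodule P1 P2 => c *: h1 x.1 + h2 x.2)
    (GRing.isLinear.Build k (dsum_bimodule P1 P2) regC *:%R _ hlin).
exists (linfun G), (linfun H); split.
- split=> [a u | u b]; rewrite !lfunE /=; congr pair; by [exact: gl1 | exact: gl2 | exact: gr1 | exact: gr2].
- split=> [a u | u b]; rewrite !lfunE /=.
    by rewrite hl1 hl2 /= mulrDr scalerAr.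
  by rewrite hr1 hr2 /= mulrDl scalerAl.
- apply/lfunP=> x; rewrite comp_lfunE !lfunE /= E1 E2.
  by rewrite !(add_lfunE, scale_lfunE, comp_lfunE).
Qed.

(* Z^pr(C), with End_{C^e}(C) identified with Z(C) via f |-> f 1. *)
Definition proj_center : {vspace center} := vspace_of in_proj_center_closed.

Lemma proj_center_mull (y z : center) :
  z \in proj_center -> y * z \in proj_center.
Proof.
move=> /mem_vspace_of[f [homf [P projP [g [h [homg homh fE]]]] f1]].
have homy : bimod_hom (amull (vsval y) : 'Hom(regC, regC)).
  by split=> [a x | x b]; rewrite !lfunE /= mulrA // centerC mulrA.
apply/mem_vspace_of; exists (amull (vsval y) \o f)%VF; split.
- exact: (@bimod_hom_comp regC regC regC _ _ homy homf).
- exists P => //; exists g, (amull (vsval y) \o h)%VF.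
  by split=> //; [exact: (@bimod_hom_comp P regC regC _ _ homy homh) | rewrite fE comp_lfunA].
- by rewrite comp_lfunE f1 lfunE.
Qed.

Lemma proj_center_mulr (y z : center) :
  z \in proj_center -> z * y \in proj_center.
Proof.
suff -> : z * y = y * z by exact: proj_center_mull.
by apply: val_inj; rewrite /= centerC.
Qed.

(* Z^st(C) = Z(C) / Z^pr(C) vanishes when C is separable, hence carries a
   possibly zero ring structure beside its k-vector space structure. *)
Definition stable_center : Type := quotvs proj_center.
HB.instance Definition _ := Vector.on stable_center.

Definition stc_pi (z : center) : stable_center := quot_pi proj_center z.
Definition stc_repr (x : stable_center) : center := quot_repr x.
Definition stc_mul (x y : stable_center) : stable_center :=
  stc_pi (stc_repr x * stc_repr y).

Lemma stc_reprK : cancel stc_repr stc_pi. Proof. exact: quot_reprK. Qed.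

Lemma stc_piM (y z : center) : stc_pi (y * z) = stc_mul (stc_pi y) (stc_pi z).
Proof.
apply/esym/eqP; rewrite quot_pi_eq.
rewrite -(subrK (y * stc_repr (stc_pi z)) (_ * _)) -mulrBl -addrA -mulrBr.
by apply: memvD; [apply/proj_center_mulr/quot_piK|apply/proj_center_mull/quot_piK].
Qed.

Fact stc_piD : {morph stc_pi : y z / y + z}. Proof. exact: linearD. Qed.

Fact stc_mulA : associative stc_mul.
Proof.
move=> x y z; rewrite -(stc_reprK x) -(stc_reprK y) -(stc_reprK z).
by rewrite -!stc_piM mulrA.
Qed.
Fact stc_mul1 : left_id (stc_pi 1) stc_mul.
Proof. by move=> x; rewrite -(stc_reprK x) -stc_piM mul1r. Qed.
Fact stc_1mul : right_id (stc_pi 1) stc_mul.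
Proof. by move=> x; rewrite -(stc_reprK x) -stc_piM mulr1. Qed.
Fact stc_mulDl : left_distributive stc_mul +%R.
Proof.
move=> x y z; rewrite -(stc_reprK x) -(stc_reprK y) -(stc_reprK z).
by rewrite -!(stc_piM, stc_piD) mulrDl.
Qed.
Fact stc_mulDr : right_distributive stc_mul +%R.
Proof.
move=> x y z; rewrite -(stc_reprK x) -(stc_reprK y) -(stc_reprK z).
by rewrite -!(stc_piM, stc_piD) mulrDr.
Qed.
HB.instance Definition _ := GRing.Zmodule_isPzRing.Build stable_center
  stc_mulA stc_mul1 stc_1mul stc_mulDl stc_mulDr.

End StableCenter.

Section StableCenterIso.
Variables (k : fieldType) (C D : falgType k).

Definition stable_centers_isomorphic : Prop :=
  exists f : stable_center C -> stable_center D,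
    [/\ bijective f, linear f & monoid_morphism f].
End StableCenterIso.

Section VectorTensor.
Variables (k : fieldType) (V W : vectType k).

(* V (x)_k W as matrices: coordinates in the basis v_i (x) w_j. *)
Definition tensk_space : vectType k := 'M[k]_(\dim {:V}, \dim {:W}).

Definition tensk (x : V) (y : W) : tensk_space :=
  \matrix_(i, j) (coord (vbasis {:V}) i x * coord (vbasis {:W}) j y).

Definition bilinear_map (T : vectType k) (f : V -> W -> T) : Prop :=
  (forall y, linear (fun x => f x y)) /\ (forall x, linear (f x)).

Lemma tensk_bilinear : bilinear_map tensk.
Proof.
split=> [y c u v | x c u v]; apply/matrixP=> i j; rewrite !mxE linearP.
  by rewrite mulrDl mulrA.
by rewrite mulrDr mulrCA.
Qed.

Definition tensk_lift_fun (T : vectType k) (f : V -> W -> T) (t : tensk_space) : T :=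
  \sum_i \sum_j t i j *: f (vbasis {:V})`_i (vbasis {:W})`_j.

Fact tensk_lift_linear (T : vectType k) f : linear (@tensk_lift_fun T f).
Proof.
move=> c s t; rewrite /tensk_lift_fun scaler_sumr -big_split /=.
apply: eq_bigr => i _; rewrite scaler_sumr -big_split /=.
by apply: eq_bigr => j _; rewrite !mxE scalerDl scalerA.
Qed.
HB.instance Definition _ (T : vectType k) f :=
  GRing.isLinear.Build k tensk_space T *:%R _ (@tensk_lift_linear T f).

Definition tensk_lift (T : vectType k) (f : V -> W -> T) : 'Hom(tensk_space, T) :=
  linfun (tensk_lift_fun f).

Lemma sum_linear (U T : vectType k) (f : U -> T) (I : finType)
    (c : I -> k) (u : I -> U) :
  linear f -> f (\sum_i c i *: u i) = \sum_i c i *: f (u i).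
Proof.
move=> linf; pose F : {linear U -> T} :=
  HB.pack f (GRing.isLinear.Build k U T *:%R _ linf).
by rewrite -[f]/(F : U -> T) linear_sum; apply: eq_bigr => i _; rewrite linearZ.
Qed.

Lemma tensk_liftE T f x y : @bilinear_map T f -> tensk_lift f (tensk x y) = f x y.
Proof.
move=> [fl fr]; rewrite lfunE /= /tensk_lift_fun.
rewrite [in RHS](coord_vbasis (memvf x)) (sum_linear _ _ (fl y)).
apply: eq_bigr => i _.
rewrite [in RHS](coord_vbasis (memvf y)) (sum_linear _ _ (fr _)) scaler_sumr.
by apply: eq_bigr => j _; rewrite mxE scalerA.
Qed.

Lemma tensk_ext (T : vectType k) (f g : 'Hom(tensk_space, T)) :
  (forall x y, f (tensk x y) = g (tensk x y)) -> f = g.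
Proof.
move=> fg; apply/lfunP=> t; rewrite [t]matrix_sum_delta !linear_sum.
apply: eq_bigr => i _; rewrite !linear_sum; apply: eq_bigr => j _.
rewrite !linearZ /=; congr (_ *: _).
suff -> : delta_mx i j = tensk (vbasis {:V})`_i (vbasis {:W})`_j by [].
apply/matrixP=> i' j'; rewrite !mxE !coord_free ?(basis_free (vbasisP _)) //.
by rewrite -natrM mulnb (eq_sym i) (eq_sym j).
Qed.

End VectorTensor.

Section TensorProduct.
Variables (k : fieldType) (B C D : falgType k).
Variables (M : bimodule B C) (N : bimodule C D).

Definition tens_relation (t : tensk_space M N) : Prop :=
  exists x c y, t = tensk (br x c) y - tensk x (bl c y).

Definition tens_space : Type := quotvs (vspan tens_relation).
HB.instance Definition _ := Vector.on tens_space.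

Definition tens (x : M) (y : N) : tens_space :=
  quot_pi (vspan tens_relation) (tensk x y).

Definition balanced_map (T : vectType k) (f : M -> N -> T) : Prop :=
  bilinear_map f /\ forall x c y, f (br x c) y = f x (bl c y).

Lemma tens_balanced : balanced_map tens.
Proof.
have [tl tr] := tensk_bilinear M N.
split; first split=> [y c u v | x c u v].
- by rewrite /tens (tl y c u v) linearP.
- by rewrite /tens (tr x c u v) linearP.
move=> x c y; apply/eqP; rewrite quot_pi_eq; apply: mem_vspan.
by exists x, c, y.
Qed.

Definition tens_repr : 'Hom(tens_space, tensk_space M N) :=
  linfun (@quot_repr k _ (vspan tens_relation)).

Definition tens_lift (T : vectType k) (f : M -> N -> T) : 'Hom(tens_space, T) :=
  (tensk_lift f \o tens_repr)%VF.

(* Universal property of the tensor product. *)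
Lemma tens_liftE T f x y : @balanced_map T f -> tens_lift f (tens x y) = f x y.
Proof.
move=> [bf balf]; rewrite comp_lfunE [tens_repr _]lfunE /= -(tensk_liftE x y bf); apply/eqP.
rewrite -subr_eq0 -linearB -memv_ker.
apply: (subvP _ _ (quot_piK _ _)); apply: vspan_min => _ [u [c [v ->]]].
by rewrite memv_ker linearB /= !tensk_liftE // balf subrr.
Qed.

Lemma tens_ext (T : vectType k) (f g : 'Hom(tens_space, T)) :
  (forall x y, f (tens x y) = g (tens x y)) -> f = g.
Proof.
move=> fg; pose p : 'Hom(tensk_space M N, tens_space) :=
  linfun (quot_pi (vspan tens_relation)).
have fgp : (f \o p = g \o p)%VF.
  by apply: tensk_ext => x y; rewrite !comp_lfunE lfunE; apply: fg.
apply/lfunP=> t; rewrite -[t]quot_reprK.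
by have /lfunP/(_ (quot_repr t)) := fgp; rewrite !comp_lfunE !lfunE.
Qed.

Definition tens_bl (a : B) : 'Hom(tens_space, tens_space) :=
  tens_lift (fun x y => tens (bl a x) y).
Definition tens_br (b : D) : 'Hom(tens_space, tens_space) :=
  tens_lift (fun x y => tens x (br y b)).

Lemma tens_blE a x y : tens_bl a (tens x y) = tens (bl a x) y.
Proof.
have [[tl tr] tb] := tens_balanced.
rewrite /tens_bl tens_liftE //; split; last by move=> u c v; rewrite -blr tb.
split=> [v c u u' | u c v v']; last exact: tr.
by rewrite bl_linearr; apply: tl.
Qed.

Lemma tens_brE b x y : tens_br b (tens x y) = tens x (br y b).
Proof.
have [[tl tr] tb] := tens_balanced.
rewrite /tens_br tens_liftE //; split; last by move=> u c v; rewrite blr tb.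
split=> [v c u u' | u c v v']; first exact: tl.
by rewrite br_linearl; apply: tr.
Qed.

Fact tens_bl_linearl t : linear (fun a => tens_bl a t).
Proof.
move=> c a b; have -> : tens_bl (c *: a + b) = c *: tens_bl a + tens_bl b.
  apply: tens_ext => x y; rewrite !(add_lfunE, scale_lfunE) !tens_blE.
  by have [[tl _] _] := tens_balanced; rewrite bl_linearl; apply: tl.
by rewrite !(add_lfunE, scale_lfunE).
Qed.
Fact tens_bl_linearr a : linear (tens_bl a). Proof. exact: linearP. Qed.
Fact tens_br_linearl b : linear (fun t => tens_br b t).
Proof. exact: linearP. Qed.
Fact tens_br_linearr t : linear (fun b => tens_br b t).
Proof.
move=> c a b; have -> : tens_br (c *: a + b) = c *: tens_br a + tens_br b.
  apply: tens_ext => x y; rewrite !(add_lfunE, scale_lfunE) !tens_brE.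
  by have [[_ tr] _] := tens_balanced; rewrite br_linearr; apply: tr.
by rewrite !(add_lfunE, scale_lfunE).
Qed.
Fact tens_bl1 t : tens_bl 1 t = t.
Proof.
rewrite -[RHS]id_lfunE; congr (fun_of_lfun _ t).
by apply: tens_ext => x y; rewrite tens_blE bl1 id_lfunE.
Qed.
Fact tens_blM a b t : tens_bl (a * b) t = tens_bl a (tens_bl b t).
Proof.
rewrite -[RHS]comp_lfunE; congr (fun_of_lfun _ t).
by apply: tens_ext => x y; rewrite [RHS]comp_lfunE !tens_blE blM.
Qed.
Fact tens_br1 t : tens_br 1 t = t.
Proof.
rewrite -[RHS]id_lfunE; congr (fun_of_lfun _ t).
by apply: tens_ext => x y; rewrite tens_brE br1 id_lfunE.
Qed.
Fact tens_brM a b t : tens_br (a * b) t = tens_br b (tens_br a t).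
Proof.
rewrite -[RHS]comp_lfunE; congr (fun_of_lfun _ t).
by apply: tens_ext => x y; rewrite [RHS]comp_lfunE !tens_brE brM.
Qed.
Fact tens_blr a t b : tens_br b (tens_bl a t) = tens_bl a (tens_br b t).
Proof.
rewrite -[LHS]comp_lfunE -[RHS]comp_lfunE; congr (fun_of_lfun _ t).
by apply: tens_ext => x y; rewrite [LHS]comp_lfunE [RHS]comp_lfunE !(tens_blE, tens_brE).
Qed.

Definition tensor : bimodule B D :=
  @Bimodule k B D tens_space (fun a t => tens_bl a t) (fun t b => tens_br b t)
    tens_bl_linearl tens_bl_linearr tens_br_linearl tens_br_linearr
    tens_bl1 tens_blM tens_br1 tens_brM tens_blr.

End TensorProduct.

Section StableEquivalence.
Variables (k : fieldType) (C D : falgType k).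

Definition stably_equivalent_of_Morita_type : Prop :=
  exists (M : bimodule C D) (N : bimodule D C)
         (P : bimodule C C) (Q : bimodule D D),
  [/\ lmod_projective (left_module M) /\ lmod_projective (right_module M),
      lmod_projective (left_module N) /\ lmod_projective (right_module N),
      bimod_projective P /\ bimod_projective Q,
      bimod_iso (tensor M N) (dsum_bimodule (reg_bimodule C) P)
    & bimod_iso (tensor N M) (dsum_bimodule (reg_bimodule D) Q)].

End StableEquivalence.

Section Dihedral.
Variable k : fieldType.

Definition D8_relations (B : algType k) (a b : B) : Prop :=
  [/\ a ^+ 2 = 0, b ^+ 2 = 0 & (a * b) ^+ 2 - (b * a) ^+ 2 = 0].

(* A = k<alpha, beta> / (alpha^2, beta^2, (alpha beta)^2 - (beta alpha)^2),
   by the universal property of an algebra given by generators and relations. *)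
Definition D8_presentation (A : algType k) (alpha beta : A) : Prop :=
  D8_relations alpha beta /\
  forall (B : algType k) (a b : B), D8_relations a b ->
    (exists f : {lrmorphism A -> B}, f alpha = a /\ f beta = b) /\
    (forall f g : {lrmorphism A -> B},
       f alpha = a /\ f beta = b -> g alpha = a /\ g beta = b -> f =1 g).
End Dihedral.

(* Main.v *)
(** Two elements of square zero in the stable center of T(Lambda) have product zero,
    whereas this fails for T(Gamma).

    In Z(T(Lambda)) the elements of augmentation zero multiply to zero: a trace form
    on Lambda vanishes on the socle element abab of A, which factors through S.

    In Z(T(Gamma)) take x = (s, 0) with s = ab + ba and y = (0, phi) with phi a trace
    form on Gamma.  An element of Z^pr is the product of a Casimir element, so for
    the symmetrizing form lam and the idempotent eps of X the value lam(x y eps)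
    would be the trace of left multiplication by some w on T(Gamma) eps.  This trace
    vanishes in characteristic 2, since T(Gamma) eps is the sum of Gamma eps and the
    dual of eps Gamma, on which w has the same trace; but lam(x y eps) = phi(eps s) = 1.

    For a stable equivalence given by M and N, multiplication in the middle of
    M (x) N transports central elements, multiplicatively modulo Z^pr, and an element
    transported into Z^pr is itself the product of a Casimir element. *)
From HB Require Import structures.
Require Import Defs.
From mathcomp Require Import all_boot all_order all_algebra all_field ring.
Set Implicit Arguments.
Unset Strict Implicit.
Unset Printing Implicit Defensive.
Import GRing.Theory.
Local Open Scope ring_scope.

(** * Linear maps and finite sums *)

Section LinearMaps.
Variable k : fieldType.

(** The two modules differ in the action of the central element ab + ba. On S it is zero, so it acts
    on the summand A alone, where a trace form takes equal values at ab and ba and their sum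
    cancels. On X it maps the top onto the socle, and a trace form can take the value 1 at this map.
    Cutting by the idempotent of X isolates this value and reduces the trace to two spaces of
    dimension 5.

    The condition on products is stated with squares modulo Z^pr because in this form it speaks of
    the ring Z^st only, and it holds trivially when Z^st is zero. Along a stable equivalence
    elements travel in one direction, from T(Gamma) to T(Lambda); what has to be controlled is
    multiplicativity and the preimage of Z^pr. The contradiction is phrased with Casimir elements
    because a lift of a bimodule map through a tensor product over k writes them down explicitly,
    which is the input of the trace argument. *)

Definition lin_hom (U V : vectType k) (f : U -> V) (lf : linear f) : 'Hom(U, V) :=
  linfun (HB.pack_for {linear U -> V} f (GRing.isLinear.Build k U V *:%R f lf)).

Lemma lin_homE (U V : vectType k) (f : U -> V) (lf : linear f) x :
  lin_hom lf x = f x.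
Proof. by rewrite lfunE. Qed.

Lemma lfun_sum (U V : vectType k) (f : 'Hom(U, V)) (I : finType) (g : I -> U) :
  f (\sum_i g i) = \sum_i f (g i).
Proof. exact: linear_sum. Qed.

Section Consequences.
Variables (U V : vectType k) (f : U -> V) (lf : linear f).

Lemma linear_prop0 : f 0 = 0.
Proof. by rewrite -(lin_homE lf) linear0. Qed.
Lemma linear_propD u v : f (u + v) = f u + f v.
Proof. by rewrite -!(lin_homE lf) linearD. Qed.
Lemma linear_propZ a u : f (a *: u) = a *: f u.
Proof. by rewrite -!(lin_homE lf) linearZ. Qed.
Lemma linear_propB u v : f (u - v) = f u - f v.
Proof. by rewrite -!(lin_homE lf) linearB. Qed.
Lemma linear_prop_sum (I : finType) (g : I -> U) : f (\sum_i g i) = \sum_i f (g i).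
Proof. by rewrite -(lin_homE lf) linear_sum; apply: eq_bigr => i _; apply: lin_homE. Qed.

End Consequences.
End LinearMaps.

Section BimoduleSums.
Variables (k : fieldType) (C D : falgType k) (M : bimodule C D) (I : finType).

Lemma bl_sum a (g : I -> M) : bl a (\sum_i g i) = \sum_i bl a (g i).
Proof. exact (linear_prop_sum (bl_linearr a) g). Qed.
Lemma br_sum b (g : I -> M) : br (\sum_i g i) b = \sum_i br (g i) b.
Proof. exact (linear_prop_sum (br_linearl b) g). Qed.

End BimoduleSums.

(** * Tensor products over the ground field *)

Section TensorOverField.
Variable k : fieldType.

Lemma tens_sum (B C D : falgType k) (M : bimodule B C) (N : bimodule C D)
    (t : tens_space M N) :
  exists (I : finType) (u : I -> M) (v : I -> N), t = \sum_i tens (u i) (v i).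
Proof.
have [[tl tr] _] := tens_balanced M N.
exists ('I_(\dim {:M}) * 'I_(\dim {:N}))%type.
exists (fun ij : 'I__ * 'I__ => quot_repr t ij.1 ij.2 *: (vbasis {:M})`_ij.1).
exists (fun ij : 'I__ * 'I__ => (vbasis {:N})`_ij.2).
have piE : linfun (quot_pi (vspan (@tens_relation k B C D M N)))
    = tensk_lift (@tens k B C D M N).
  apply: tensk_ext => x y; rewrite (tensk_liftE x y (conj tl tr)); exact: lfunE.
rewrite -[LHS]quot_reprK.
have -> : quot_pi (vspan (@tens_relation k B C D M N)) (quot_repr t)
    = tensk_lift (@tens k B C D M N) (quot_repr t) by rewrite -piE lfunE.
rewrite lfunE /= /tensk_lift_fun pair_bigA /=.
by apply: eq_bigr => ij _; rewrite (linear_propZ (tl _)).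
Qed.

Section Restriction.
Variables C D : falgType k.
Variable M : bimodule C D.

Fact rscale_linearl (c : k^o) : linear (fun x : M => (c : k) *: x).
Proof. by move=> b x y; rewrite scalerDr !scalerA mulrC. Qed.
Fact rscale_linearr (x : M) : linear (fun c : k^o => (c : k) *: x).
Proof. by move=> b c d; rewrite scalerDl -scalerA. Qed.
Fact rscaleM (a b : k^o) (x : M) : ((a * b : k^o) : k) *: x = (a : k) *: ((b : k) *: x).
Proof. by rewrite scalerA. Qed.
Fact rscaleMr (a b : k^o) (x : M) : ((a * b : k^o) : k) *: x = (b : k) *: ((a : k) *: x).
Proof. by rewrite scalerA mulrC. Qed.
Fact rscale1 (x : M) : ((1 : k^o) : k) *: x = x. Proof. exact: scale1r. Qed.
Fact blrscale (a : C) (x : M) (c : k^o) : (c : k) *: bl a x = bl a ((c : k) *: x).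
Proof. by rewrite (linear_propZ (bl_linearr a)). Qed.
Fact rscalebr (c : k^o) (x : M) (a : D) : br ((c : k) *: x) a = (c : k) *: br x a.
Proof. by rewrite (linear_propZ (br_linearl a)). Qed.

(** One action is replaced by that of the algebra k, so that a tensor product over k is an instance
    of [tensor] and inherits the two outer actions. *)
Definition forget_right : bimodule C k^o :=
  @Bimodule k C k^o M (@bl k C D M) (fun x c => (c : k) *: x)
    (@bl_linearl _ _ _ M) (@bl_linearr _ _ _ M) rscale_linearl rscale_linearr
    (@bl1 _ _ _ M) (@blM _ _ _ M) rscale1 rscaleMr blrscale.

Definition forget_left : bimodule k^o D :=
  @Bimodule k k^o D M (fun c x => (c : k) *: x) (@br k C D M)
    rscale_linearr rscale_linearl (@br_linearl _ _ _ M) (@br_linearr _ _ _ M)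
    rscale1 rscaleM (@br1 _ _ _ M) (@brM _ _ _ M) rscalebr.
End Restriction.

Section TensorK.
Variables C D D' E : falgType k.

Definition tensor_k (M : bimodule C D) (N : bimodule D' E) : bimodule C E :=
  tensor (forget_right M) (forget_left N).
Definition tens_k (M : bimodule C D) (N : bimodule D' E) (x : M) (y : N) :
  tensor_k M N := tens (x : forget_right M) (y : forget_left N).

Variables (M : bimodule C D) (N : bimodule D' E).

Lemma bilinear_balanced (T : vectType k) (f : M -> N -> T) :
  bilinear_map f -> balanced_map (M := forget_right M) (N := forget_left N) f.
Proof.
move=> [fl fr]; split=> [|x c y]; first by split.
by rewrite /= (linear_propZ (fl y)) (linear_propZ (fr x)).
Qed.

Definition tens_k_lift (T : vectType k) (f : M -> N -> T) : 'Hom(tensor_k M N, T) :=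
  tens_lift (M := forget_right M) (N := forget_left N) f.

Lemma tens_k_liftE (T : vectType k) (f : M -> N -> T) x y :
  bilinear_map f -> tens_k_lift f (tens_k x y) = f x y.
Proof. by move=> bf; apply/tens_liftE/bilinear_balanced. Qed.

Lemma tens_k_bilinear : bilinear_map (@tens_k M N).
Proof. by have [] := tens_balanced (forget_right M) (forget_left N). Qed.

Lemma tens_k_sum (t : tensor_k M N) :
  exists (I : finType) (u : I -> M) (v : I -> N), t = \sum_i tens_k (u i) (v i).
Proof. exact: tens_sum t. Qed.

Lemma bl_tens_k a (x : M) (y : N) : bl a (tens_k x y) = tens_k (bl a x) y.
Proof. exact: tens_blE. Qed.
Lemma br_tens_k b (x : M) (y : N) : br (tens_k x y) b = tens_k x (br y b).
Proof. exact: tens_brE. Qed.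

End TensorK.
End TensorOverField.

(** * Liftable bimodule maps and Casimir elements *)

Section Lifting.
Variables (k : fieldType) (C D : falgType k).

(** Stands for factoring through a projective bimodule, from which it follows; a sum is lifted term
    by term, with no common projective to construct. *)
Definition liftable (M N : bimodule C D) (f : 'Hom(M, N)) : Prop :=
  forall (L : bimodule C D) (g : 'Hom(L, N)),
    bimod_hom g -> (forall y, exists x, g x = y) ->
  exists2 h : 'Hom(M, L), bimod_hom h & forall x, g (h x) = f x.

Lemma liftable_factor (M P N : bimodule C D) (g : 'Hom(M, P)) (h : 'Hom(P, N)) :
  bimod_projective P -> bimod_hom g -> bimod_hom h -> liftable (h \o g)%VF.
Proof.
move=> projP [gl gr] homh L q homq surjq.
have [u [ul ur] qu] := projP _ _ _ _ homq surjq homh.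
exists (u \o g)%VF; first by split=> *; rewrite !comp_lfunE ?gl ?gr ?ul ?ur.
by move=> x; rewrite !comp_lfunE qu.
Qed.

Lemma liftableD (M N : bimodule C D) (f g : 'Hom(M, N)) :
  liftable f -> liftable g -> liftable (f + g).
Proof.
move=> lf lg L q homq surjq.
have [u [ul ur] qu] := lf _ _ homq surjq; have [v [vl vr] qv] := lg _ _ homq surjq.
exists (u + v); last by move=> x; rewrite !add_lfunE linearD /= qu qv.
split=> [a x | x b]; rewrite !add_lfunE ?ul ?vl ?ur ?vr.
  by rewrite (linear_propD (bl_linearr a)).
by rewrite (linear_propD (br_linearl b)).
Qed.

End Lifting.

Section Casimir.
Variables (k : fieldType) (C : falgType k).
Local Notation regC := (reg_bimodule C).

Definition mult_k : 'Hom(tensor_k regC regC, C) :=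
  tens_k_lift (M := regC) (N := regC) (fun x y : C => x * y).

Lemma mul_bilinear : bilinear_map (fun x y : C => x * y).
Proof.
split=> [y c u v | x c u v]; first by rewrite mulrDl scalerAl.
by rewrite mulrDr scalerAr.
Qed.

Lemma mult_kE x y : mult_k (tens_k (x : regC) (y : regC)) = x * y.
Proof. exact: (tens_k_liftE (M := regC) (N := regC) x y mul_bilinear). Qed.

Definition casimir (z : C) : Prop :=
  exists2 kap : tensor_k regC regC,
    (forall t, bl t kap = br kap t) & mult_k kap = z.

Lemma mult_k_hom : bimod_hom (mult_k : 'Hom(tensor_k regC regC, regC)).
Proof.
split=> [a t | t b]; have [I [u [v ->]]] := tens_k_sum t.
  rewrite bl_sum !lfun_sum [RHS]/= mulr_sumr.
  apply: eq_bigr => i _; rewrite (bl_tens_k a (u i : regC) (v i : regC)) !mult_kE.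
  by rewrite /= mulrA.
rewrite br_sum !lfun_sum [RHS]/= mulr_suml.
apply: eq_bigr => i _; rewrite (br_tens_k b (u i : regC) (v i : regC)) !mult_kE.
by rewrite /= mulrA.
Qed.

Lemma mult_k_surj y : exists x, mult_k x = y.
Proof. by exists (tens_k (y : regC) (1 : regC)); rewrite mult_kE mulr1. Qed.

(** Lift the endomorphism given by z along the multiplication map from C (x)_k C onto C; the image
    of 1 under the lift commutes with C because 1 does. *)
Lemma proj_center_casimir (z : center C) : z \in proj_center C -> casimir (vsval z).
Proof.
move=> /mem_vspace_of[f [homf [P projP [g [h [homg homh ->]]]] <-]].
have [u [ul ur] uE] :=
  liftable_factor projP homg homh mult_k_hom mult_k_surj.
exists (u (1 : C)); last by rewrite uE.
move=> t; rewrite -(ul t (1 : C)) -(ur (1 : C) t).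
by congr (u _); rewrite /= mulr1 mul1r.
Qed.

(* For a Casimir element sum u_j (x) v_j put w = sum lam(u_j) v_j; then
   sum lam(x u_j) v_j = w x, and lam(z e) is the trace of x |-> w x on C e. *)
Lemma casimir_trace (lam : 'Hom(C, k^o)) (e z : C) (I : finType)
    (xi : I -> 'Hom(C, k^o)) (F : I -> C) :
  (forall x y, lam (x * y) = lam (y * x)) ->
  (forall x, x * e = \sum_i (xi i x : k) *: F i) ->
  casimir z -> exists w, lam (z * e) = \sum_i xi i (w * F i).
Proof.
move=> lamC eE [kap kapC <-]; have [J [u [v kapE]]] := tens_k_sum kap.
exists (\sum_j (lam (u j) : k) *: (v j : C)).
pose th (x : C) := \sum_j (lam (x * u j) : k) *: (v j : C).
have thE x : th x = (\sum_j (lam (u j) : k) *: (v j : C)) * x.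
  pose bt (y z : C) : C := (lam y : k) *: z.
  have bbt : bilinear_map (bt : regC -> regC -> C).
    split=> [y' c s t | y' c s t]; rewrite /bt.
      by rewrite linearP scalerDl -scalerA.
    by rewrite scalerDr !scalerA mulrC.
  have := congr1 (tens_k_lift (bt : regC -> regC -> C)) (kapC x).
  rewrite kapE bl_sum br_sum.
  rewrite !lfun_sum.
  under eq_bigr => j _ do
    rewrite (bl_tens_k x (u j : regC) (v j : regC)) (tens_k_liftE _ _ bbt) /= /bt.
  under [X in _ = X -> _]eq_bigr => j _ do
    rewrite (br_tens_k x (u j : regC) (v j : regC)) (tens_k_liftE _ _ bbt) /= /bt.
  rewrite /th => ->.
  by rewrite mulr_suml; apply: eq_bigr => j _; rewrite scalerAl.
rewrite kapE lfun_sum.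
under eq_bigr => j _ do rewrite mult_kE.
rewrite mulr_suml linear_sum /=.
transitivity (\sum_j \sum_i lam (F i * u j) * xi i (v j)).
  apply: eq_bigr => j _; rewrite -mulrA eE mulr_sumr linear_sum /=.
  by apply: eq_bigr => i _; rewrite -scalerAr linearZ /= lamC mulrC.
rewrite exchange_big /=; apply: eq_bigr => i _.
by rewrite -thE /th linear_sum; apply: eq_bigr => j _; rewrite linearZ.
Qed.

End Casimir.
Section Center.
Variables (k : fieldType) (C : falgType k).

Lemma center_ex (z : C) : (forall x, z * x = x * z) -> exists y : center C, vsval y = z.
Proof.
move=> zC; have zZ : z \in 'Z({:C})%VS.
  by rewrite memv_cap memvf /=; apply/centvP => x _; rewrite zC.
by exists (Subvs zZ).
Qed.

End Center.

(** * Transport of central elements through M (x) N *)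

Section MiddleMultiplication.
Variables (k : fieldType) (B C D : falgType k) (M : bimodule B C) (N : bimodule C D).

(** Centrality of z makes this compatible with the relations of the tensor product. *)
Definition mid_mul (z : center C) : 'Hom(tensor M N, tensor M N) :=
  locked (tens_lift (fun x y => tens (br x (vsval z)) y)).

Lemma mid_mulE z (x : M) (y : N) :
  mid_mul z (tens x y) = tens (br x (vsval z)) y.
Proof.
have [[tl tr] tb] := tens_balanced M N.
rewrite /mid_mul -lock tens_liftE //; split; last first.
  by move=> u c v; rewrite -brM -centerC brM tb.
by split=> [v c u u' | u c v v']; [rewrite br_linearl; apply: tl | apply: tr].
Qed.

Lemma mid_mul_hom z : bimod_hom (mid_mul z).
Proof.
split=> [a t | t b]; have [I [u [v ->]]] := tens_sum t.
  rewrite bl_sum !lfun_sum bl_sum; apply: eq_bigr => i _.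
  by rewrite mid_mulE /= !tens_blE mid_mulE blr.
rewrite br_sum !lfun_sum br_sum; apply: eq_bigr => i _.
by rewrite mid_mulE /= !tens_brE mid_mulE.
Qed.

Lemma mid_mulM y z t : mid_mul (y * z) t = mid_mul y (mid_mul z t).
Proof.
have [I [u [v ->]]] := tens_sum t; rewrite !lfun_sum; apply: eq_bigr => i _.
by rewrite !mid_mulE -brM -centerC.
Qed.

End MiddleMultiplication.

Arguments mid_mul {k B C D M N} z.

Section Summand.
Variables (k : fieldType) (C : falgType k) (T : bimodule C C).
Local Notation regC := (reg_bimodule C).

(** The form in which an isomorphism of T with C (+) P is used: the complementary idempotent 1 - i j
    factors through a projective. *)
Definition stable_splitting (i : 'Hom(regC, T)) (j : 'Hom(T, regC)) : Prop :=
  [/\ bimod_hom i, bimod_hom j, forall x, j (i x) = x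
    & exists2 P : bimodule C C, bimod_projective P &
      exists (g : 'Hom(T, P)) (h : 'Hom(P, T)),
        [/\ bimod_hom g, bimod_hom h & forall t, t = i (j t) + h (g t)]].

Lemma stable_splitting_ex (P : bimodule C C) :
  bimod_projective P -> bimod_iso T (dsum_bimodule regC P) ->
  exists i j, stable_splitting i j.
Proof.
move=> projP [f [fl fr] [f' fK f'K]].
have f'lin : linear f'.
  by move=> a u v; apply: (can_inj fK); rewrite linearP /= !f'K.
have f'l a x : f' (bl a x) = bl a (f' x).
  by apply: (can_inj fK); rewrite fl !f'K.
have f'r x b : f' (br x b) = br (f' x) b.
  by apply: (can_inj fK); rewrite fr !f'K.
have bl0 (L : bimodule C C) a : bl a (0 : L) = 0 := linear_prop0 (bl_linearr a).
have br0 (L : bimodule C C) b : br (0 : L) b = 0 := linear_prop0 (br_linearl b).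
have i_lin : linear (fun x : regC => f' ((x, 0) : dsum_bimodule regC P)).
  by move=> a x y; rewrite -f'lin; congr (f' (_, _)); rewrite /= scaler0 addr0.
have h_lin : linear (fun x : P => f' ((0, x) : dsum_bimodule regC P)).
  by move=> a x y; rewrite -f'lin; congr (f' (_, _)); rewrite /= scaler0 addr0.
have j_lin : linear (fun t => (f t).1 : regC) by move=> a x y; rewrite linearP.
have g_lin : linear (fun t => (f t).2) by move=> a x y; rewrite linearP.
exists (lin_hom i_lin), (lin_hom j_lin); split.
- split=> [a x | x b]; rewrite !lin_homE -?f'l -?f'r; congr (f' _).
    by rewrite /= /bsum_bl /= bl0.
  by rewrite /= /bsum_br /= br0.
- by split=> [a x | x b]; rewrite !lin_homE ?fl ?fr.
- by move=> x; rewrite !lin_homE f'K.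
exists P => //; exists (lin_hom g_lin), (lin_hom h_lin); split.
- by split=> [a x | x b]; rewrite !lin_homE ?fl ?fr.
- split=> [a x | x b]; rewrite !lin_homE -?f'l -?f'r; congr (f' _).
    by rewrite /= /bsum_bl /= mulr0.
  by rewrite /= /bsum_br /= mul0r.
move=> t; rewrite !lin_homE -(linear_propD f'lin) -[LHS]fK; congr (f' _).
by case: (f t) => x y; congr (_, _); rewrite /= ?addr0 ?add0r.
Qed.

End Summand.

Section Transport.
Variables (k : fieldType) (C D : falgType k) (M : bimodule C D) (N : bimodule D C).
Local Notation regC := (reg_bimodule C).
Variables (i : 'Hom(regC, tensor M N)) (j : 'Hom(tensor M N, regC)).
Hypothesis ij : stable_splitting i j.

Lemma transport_bl z c : j (mid_mul z (i c)) = c * j (mid_mul z (i (1 : C))).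
Proof.
have [[il _] [jl _] _ _] := ij; have [ml _] := mid_mul_hom M N z.
have -> : i c = bl c (i (1 : C)) by rewrite -il /= mulr1.
by rewrite ml jl.
Qed.

Lemma transport_br z c : j (mid_mul z (i c)) = j (mid_mul z (i (1 : C))) * c.
Proof.
have [[_ ir] [_ jr] _ _] := ij; have [_ mr] := mid_mul_hom M N z.
have -> : i c = br (i (1 : C)) c by rewrite -ir /= mul1r.
by rewrite mr jr.
Qed.

(** The composite j z i is an endomorphism of the regular bimodule, so its value at 1 is central. *)
Lemma transport_ex (z : center D) :
  exists z' : center C, vsval z' = j (mid_mul z (i (1 : C))).
Proof. by apply: center_ex => c; rewrite -transport_br transport_bl. Qed.

(* The defect j y (1 - i j) z i of multiplicativity factors through the projective
   complement of the regular bimodule. *)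
Lemma transportM (y z : center D) (y' z' yz' : center C) :
  vsval y' = j (mid_mul y (i (1 : C))) -> vsval z' = j (mid_mul z (i (1 : C))) ->
  vsval yz' = j (mid_mul (y * z) (i (1 : C))) ->
  yz' - y' * z' \in proj_center C.
Proof.
move=> y'E z'E yz'E; have [hi hj jiK [P projP [g [h [hg hh ghE]]]]] := ij.
apply/mem_vspace_of; exists ((j \o (mid_mul y \o h)) \o (g \o (mid_mul z \o i)))%VF.
have homg : bimod_hom (g \o (mid_mul z \o i))%VF.
  apply: (@bimod_hom_comp k C regC (tensor M N) P _ _ hg).
  exact: (@bimod_hom_comp k C regC (tensor M N) (tensor M N) _ _ (mid_mul_hom M N z) hi).
have homh : bimod_hom (j \o (mid_mul y \o h))%VF.
  apply: (@bimod_hom_comp k C P (tensor M N) regC _ _ hj).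
  exact: (@bimod_hom_comp k C P (tensor M N) (tensor M N) _ _ (mid_mul_hom M N y) hh).
split.
- exact: (@bimod_hom_comp k C regC P regC _ _ homh homg).
- exists P => //; exists (g \o (mid_mul z \o i))%VF, (j \o (mid_mul y \o h))%VF.
  by split.
rewrite !comp_lfunE /= y'E z'E yz'E mid_mulM -transport_br -linearB -linearB /=.
congr (j (mid_mul y _)).
by apply/esym/eqP; rewrite subr_eq addrC; apply/eqP/ghE.
Qed.

End Transport.

(** * From a transported element to a Casimir element *)

Section StableEquivalenceCasimir.
Variables (k : fieldType) (C D : falgType k) (M : bimodule C D) (N : bimodule D C).
Local Notation regC := (reg_bimodule C).
Local Notation regD := (reg_bimodule D).

Definition tensor_proj : 'Hom(tensor_k N M, tensor N M) :=
  tens_k_lift (fun x y => tens x y).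

Lemma tensor_projE x y : tensor_proj (tens_k x y) = tens x y.
Proof. by apply: tens_k_liftE; have [] := tens_balanced N M. Qed.

Lemma tensor_proj_hom : bimod_hom tensor_proj.
Proof.
split=> [a t | t b]; have [I [u [v ->]]] := tens_k_sum t.
  rewrite bl_sum !lfun_sum bl_sum; apply: eq_bigr => i _.
  by rewrite bl_tens_k !tensor_projE [RHS]tens_blE.
rewrite br_sum !lfun_sum br_sum; apply: eq_bigr => i _.
by rewrite br_tens_k !tensor_projE [RHS]tens_brE.
Qed.

Lemma tensor_proj_surj t : exists s, tensor_proj s = t.
Proof.
have [I [u [v ->]]] := tens_sum t; exists (\sum_i tens_k (u i) (v i)).
by rewrite lfun_sum; apply: eq_bigr => i _; rewrite tensor_projE.
Qed.

(** With 1 = i j + h g one has z = i (j z i) j + h g z i j + z h g. The first term factors through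
    the projective that carries z', the other two through the complement Q. *)
Lemma mid_mul_liftable (i : 'Hom(regD, tensor N M)) (j : 'Hom(tensor N M, regD))
    (z : center C) (z' : center D) :
  stable_splitting i j -> vsval z' = j (mid_mul z (i (1 : D))) ->
  z' \in proj_center D -> liftable (mid_mul z : 'Hom(tensor N M, tensor N M)).
Proof.
move=> ij z'E /mem_vspace_of[f [[fl fr] [P0 projP0 [g0 [h0 [hg0 hh0 fE]]]] f1]].
have [hi hj jiK [Q projQ [g [h [hg hh ghE]]]]] := ij.
have hm := mid_mul_hom N M z; pose T := tensor N M.
have -> : mid_mul z = ((i \o h0) \o (g0 \o j))%VF +
    ((h \o (g \o (mid_mul z \o (i \o j))))%VF + ((mid_mul z \o h) \o g)%VF)
    :> 'Hom(tensor N M, tensor N M).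
  apply/lfunP => t; rewrite !add_lfunE !comp_lfunE [in LHS](ghE t) linearD /=.
  rewrite addrA; congr (_ + _); rewrite [in LHS](ghE (mid_mul z _)); congr (i _ + _).
  rewrite (transport_br ij) -z'E -f1 -[RHS]comp_lfunE -fE.
  by rewrite -[LHS]/(br (f (1 : D)) (j t)) -fr /= mul1r.
apply: liftableD; last apply: liftableD.
- apply: (liftable_factor projP0).
    exact: (@bimod_hom_comp k D T regD P0 _ _ hg0 hj).
  exact: (@bimod_hom_comp k D P0 regD T _ _ hi hh0).
- apply: (liftable_factor projQ _ hh).
  apply: (@bimod_hom_comp k D T T Q _ _ hg).
  apply: (@bimod_hom_comp k D T T T _ _ hm).
  exact: (@bimod_hom_comp k D T regD T _ _ hi hj).
- apply: (liftable_factor projQ hg).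
  exact: (@bimod_hom_comp k D Q T T _ _ hm hh).
Qed.

Section Lift.
Variable z : center C.
Variable sig : 'Hom(tensor N M, tensor_k N M).
Hypothesis sig_hom : bimod_hom sig.
Hypothesis sigE : forall t, tensor_proj (sig t) = mid_mul z t.
Variable j : 'Hom(tensor M N, regC).
Hypothesis j_hom : bimod_hom j.

Let contr (x : M) (y : N) (n : N) (m : M) : tensor_k regC regC :=
  tens_k (j (tens x n)) (j (tens m y)).

Let contr_bilinear x y : bilinear_map (contr x y).
Proof.
have [tl tr] := tens_k_bilinear regC regC.
have [[sl sr] _] := tens_balanced M N.
split=> [m c u v | n c u v]; rewrite /contr.
  by rewrite sr linearP; apply: tl.
by rewrite sl linearP; apply: tr.
Qed.

(** A map on M (x) N (x) M (x) N: the lift [sig] is applied to the two middle factors, and [j]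
    contracts what it returns with the outer ones. *)
Let cas (x : M) (n : N) (m : M) (y : N) : tensor_k regC regC :=
  tens_k_lift (contr x y) (sig (tens n m)).

Let cas_expand n m :
  exists (I : finType) (u : I -> N) (v : I -> M), forall x y,
    cas x n m y = \sum_i contr x y (u i) (v i).
Proof.
have [I [u [v uvE]]] := tens_k_sum (sig (tens n m)); exists I, u, v => x y.
rewrite /cas uvE lfun_sum; apply: eq_bigr => i _.
exact/tens_k_liftE/contr_bilinear.
Qed.

Let cas_bl t x n m y : bl t (cas x n m y) = cas (bl t x) n m y.
Proof.
have [I [u [v uvE]]] := cas_expand n m; rewrite !uvE bl_sum.
apply: eq_bigr => i _; rewrite /contr bl_tens_k; congr (tens_k _ _).
by rewrite -tens_blE; have [<-] := j_hom.
Qed.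

Let cas_br t x n m y : br (cas x n m y) t = cas x n m (br y t).
Proof.
have [I [u [v uvE]]] := cas_expand n m; rewrite !uvE br_sum.
apply: eq_bigr => i _; rewrite /contr br_tens_k; congr (tens_k _ _).
by rewrite -tens_brE; have [_ <-] := j_hom.
Qed.

Let cas_mid t x n m y : cas x (br n t) m y = cas x n (bl t m) y.
Proof. by rewrite /cas; have [_ ->] := tens_balanced N M. Qed.

Let cas_balanced_l m y : balanced_map (fun x n => cas x n m y).
Proof.
have [tl tr] := tens_k_bilinear regC regC.
have [[sl sr] sb] := tens_balanced M N.
have [[pl _] _] := tens_balanced N M.
split; first split=> [n c x x' | x c n n'].
- have [I [u [v uvE]]] := cas_expand n m; rewrite !uvE scaler_sumr -big_split /=.
  by apply: eq_bigr => i _; rewrite /contr sl linearP; apply: tl.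
- by rewrite /cas pl !linearP.
move=> x d n.
have [I [u [v uvE]]] := tens_k_sum (sig (tens n m)).
have -> : cas x (bl d n) m y = tens_k_lift (contr x y) (bl d (sig (tens n m))).
  by have [<- _] := sig_hom; rewrite /= tens_blE.
rewrite /cas uvE bl_sum !lfun_sum; apply: eq_bigr => i _.
rewrite bl_tens_k !tens_k_liftE; try exact: contr_bilinear.
by rewrite /contr sb.
Qed.

Let cas_balanced_r x n : balanced_map (fun m y => cas x n m y).
Proof.
have [tl tr] := tens_k_bilinear regC regC.
have [[sl sr] sb] := tens_balanced M N.
have [[_ pr] _] := tens_balanced N M.
split; first split=> [y c m m' | m c y y'].
- by rewrite /cas pr !linearP.
- have [I [u [v uvE]]] := cas_expand n m; rewrite !uvE scaler_sumr -big_split /=.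
  by apply: eq_bigr => i _; rewrite /contr sr linearP; apply: tr.
move=> m d y.
have [I [u [v uvE]]] := tens_k_sum (sig (tens n m)).
have -> : cas x n (br m d) y = tens_k_lift (contr x y) (br (sig (tens n m)) d).
  by have [_ <-] := sig_hom; rewrite /= tens_brE.
rewrite /cas uvE br_sum !lfun_sum; apply: eq_bigr => i _.
rewrite br_tens_k !tens_k_liftE; try exact: contr_bilinear.
by rewrite /contr sb.
Qed.

(** The product of the two contractions is the sum of j (x (x) n' j (m' (x) y)) over the terms n'
    (x) m' of the lift. The expression n' j (m' (x) y) is balanced over C, so only the image of the
    lift in N (x)_C M counts, and this is z applied to n (x) m. *)
Let mult_cas x n m y : mult_k C (cas x n m y) = j (tens x n) * vsval z * j (tens m y).
Proof.
have [[sl sr] sb] := tens_balanced M N.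
have [_ jr] := j_hom.
pose th (n' : N) (m' : M) : N := br n' (j (tens m' y) : C).
have thb : balanced_map th.
  split; first split=> [m' c u v | n' c u v].
  - exact: br_linearl.
  - by rewrite /th sl linearP; apply: br_linearr.
  by move=> n' c m'; rewrite /th -brM -tens_blE; have [-> _] := j_hom.
have thE : tens_lift th (mid_mul z (tens n m)) = br (br n (vsval z)) (j (tens m y) : C).
  by rewrite mid_mulE tens_liftE.
have [I [u [v uvE]]] := tens_k_sum (sig (tens n m)).
transitivity (j (tens x (tens_lift th (mid_mul z (tens n m))))).
  rewrite -sigE /cas uvE !lfun_sum (linear_prop_sum (sr x)) lfun_sum.
  apply: eq_bigr => i _; rewrite (tens_k_liftE _ _ (contr_bilinear x y)) tensor_projE.
  by rewrite (tens_liftE _ _ thb) /contr /th -tens_brE jr mult_kE.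
by rewrite thE -!tens_brE !jr.
Qed.

(* For c = sum_p u_p (x) v_p the element
   sum_(p, q) (j (u_p (x) -) (x) j (- (x) v_q)) (sig (v_p (x) u_q))
   is a Casimir element with product j c * z * j c. *)
Lemma casimir_of_lift (c : tensor M N) :
  (forall t, bl t c = br c t) -> j c = 1 -> casimir (vsval z).
Proof.
move=> cC jc1; have [I [u [v cE]]] := tens_sum c.
have swap (T : vectType k) (f : M -> N -> T) (t : C) : balanced_map f ->
    \sum_p f (bl t (u p)) (v p) = \sum_p f (u p) (br (v p) t) :> T.
  move=> bf; have := congr1 (tens_lift f) (cC t).
  rewrite cE bl_sum br_sum !lfun_sum.
  under eq_bigr => p _ do rewrite [bl _ _]tens_blE tens_liftE //.
  by under [X in _ = X -> _]eq_bigr => p _ do rewrite [br _ _]tens_brE tens_liftE //.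
exists (\sum_p \sum_q cas (u p) (v p) (u q) (v q)).
  (* The factor t passes from u_p to v_p because c commutes with t, from v_p to u_q across the
     middle tensor product over C, and from u_q to v_q because c commutes with t again. *)
  move=> t; rewrite bl_sum br_sum.
  under eq_bigr => p _.
    rewrite bl_sum; under eq_bigr => q _ do rewrite cas_bl; over.
  rewrite [LHS]exchange_big [LHS]/=.
  under eq_bigr => q _ do rewrite (swap _ _ t (cas_balanced_l (u q) (v q))).
  rewrite [LHS]exchange_big [LHS]/=; apply: eq_bigr => p _; rewrite br_sum.
  under eq_bigr => q _ do rewrite cas_mid.
  rewrite (swap _ _ t (cas_balanced_r (u p) (v p))).
  by apply: eq_bigr => q _; rewrite cas_br.
rewrite lfun_sum; under eq_bigr => p _.
  rewrite lfun_sum; under eq_bigr => q _ do rewrite mult_cas.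
  rewrite -mulr_sumr -lfun_sum -cE jc1 mulr1; over.
by rewrite -mulr_suml -lfun_sum -cE jc1 mul1r.
Qed.

End Lift.

Lemma stable_equiv_casimir (i : 'Hom(regC, tensor M N)) (j : 'Hom(tensor M N, regC))
    (i2 : 'Hom(regD, tensor N M)) (j2 : 'Hom(tensor N M, regD))
    (z : center C) (z' : center D) :
  stable_splitting i j -> stable_splitting i2 j2 ->
  vsval z' = j2 (mid_mul z (i2 (1 : D))) -> z' \in proj_center D ->
  casimir (vsval z).
Proof.
move=> [[il ir] homj jiK _] ij2 z'E z'pr.
have [sig homs sigE] := mid_mul_liftable ij2 z'E z'pr tensor_proj_hom tensor_proj_surj.
apply: (casimir_of_lift homs sigE homj (c := i (1 : C))); last exact: jiK.
by move=> t; rewrite -il -ir /= mulr1 mul1r.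
Qed.

End StableEquivalenceCasimir.

(** * An orthogonality condition and its invariance *)

Section Invariant.
Variables (k : fieldType) (C D : falgType k).

Lemma stc_pi_eq0 (E : falgType k) (z : center E) :
  (stc_pi z == 0) = (z \in proj_center E).
Proof. exact: quot_pi_eq0. Qed.

(** The classes of x and y pull back to classes of square zero, whose representatives fall under the
    hypothesis on C; f carries the vanishing of the product back. *)
Lemma stable_center_iso_orthogonal :
  (forall x y : center C, x * x \in proj_center C -> y * y \in proj_center C ->
     x * y \in proj_center C) ->
  stable_centers_isomorphic C D ->
  forall x y : center D, x * x = 0 -> y * y = 0 -> x * y \in proj_center D.
Proof.
move=> orthC [f [[g fK gK] linf [_ fM]]] x y xx0 yy0.
have f0 : f 0 = 0 := linear_prop0 linf.
have pi0 : stc_pi (0 : center D) = 0 by exact: linear0.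
have sq0 (z : center D) : z * z = 0 ->
    stc_repr (g (stc_pi z)) * stc_repr (g (stc_pi z)) \in proj_center C.
  move=> zz0; rewrite -stc_pi_eq0 stc_piM stc_reprK; apply/eqP.
  by apply: (can_inj fK); rewrite f0 [LHS]fM gK -[LHS]stc_piM zz0.
have := orthC _ _ (sq0 _ xx0) (sq0 _ yy0).
rewrite -!stc_pi_eq0 !stc_piM !stc_reprK => /eqP/(congr1 f).
by rewrite f0 [f _]fM !gK => /eqP.
Qed.

(** The elements go from D to C, where the hypothesis applies; the conclusion returns to D by
    [stable_equiv_casimir] with the two bimodules exchanged. *)
Lemma stable_equivalence_orthogonal :
  (forall x y : center C, x * x \in proj_center C -> y * y \in proj_center C ->
     x * y \in proj_center C) ->
  stably_equivalent_of_Morita_type C D ->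
  forall x y : center D, x * x = 0 -> y * y = 0 -> casimir (vsval (x * y)).
Proof.
move=> orthC [M [N [P [Q [_ _ [projP projQ] isoMN isoNM]]]]] x y xx0 yy0.
have [i [j ij]] := stable_splitting_ex projP isoMN.
have [i' [j' ij']] := stable_splitting_ex projQ isoNM.
have tr0 (t' : center C) : vsval t' = j (mid_mul (0 : center D) (i (1 : C))) -> t' = 0.
  move=> t'E; apply: val_inj; rewrite /= t'E.
  have [I [u [v ->]]] := tens_sum (i (1 : C)).
  rewrite lfun_sum lfun_sum big1 // => p _; rewrite mid_mulE /=.
  have [[tl _] _] := tens_balanced M N.
  by rewrite (linear_prop0 (br_linearr (u p))) (linear_prop0 (tl _)) linear0.
(* The transport of z z = 0 is exactly 0, so z' z' is the multiplicativity defect up to sign and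
   lies in Z^pr. *)
have sq0 (z : center D) (z' : center C) : z * z = 0 ->
    vsval z' = j (mid_mul z (i (1 : C))) -> z' * z' \in proj_center C.
  move=> zz0 z'E; have [zz' zz'E] := transport_ex ij (z * z).
  have := transportM ij z'E z'E zz'E; rewrite zz0 in zz'E.
  by rewrite (tr0 _ zz'E) sub0r memvN.
have [x' x'E] := transport_ex ij x; have [y' y'E] := transport_ex ij y.
have [xy' xy'E] := transport_ex ij (x * y).
apply: (stable_equiv_casimir ij' ij xy'E).
have := orthC _ _ (sq0 _ _ xx0 x'E) (sq0 _ _ yy0 y'E).
by move=> /(memvD (transportM ij x'E y'E xy'E)); rewrite subrK.
Qed.

End Invariant.

(** * Words in the generators and the basis of A *)

Section Words.
Variables (k : fieldType) (A : algType k) (a b : A).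

Fact word_comb_key : unit. Proof. exact: tt. Qed.

Definition word_comb (x0 x1 x2 x3 x4 x5 x6 x7 : k) : A :=
  locked_with word_comb_key (x0 *: 1 + x1 *: a + x2 *: b + x3 *: (a * b) + x4 *: (b * a) + x5 *: (a * b * a)
  + x6 *: (b * a * b) + x7 *: (a * b * a * b)).

Lemma word_combE x0 x1 x2 x3 x4 x5 x6 x7 :
  word_comb x0 x1 x2 x3 x4 x5 x6 x7 =
  x0 *: 1 + x1 *: a + x2 *: b + x3 *: (a * b) + x4 *: (b * a) + x5 *: (a * b * a)
  + x6 *: (b * a * b) + x7 *: (a * b * a * b).
Proof. by rewrite /word_comb unlock. Qed.

Lemma word_combD x0 x1 x2 x3 x4 x5 x6 x7 y0 y1 y2 y3 y4 y5 y6 y7 :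
  word_comb x0 x1 x2 x3 x4 x5 x6 x7 + word_comb y0 y1 y2 y3 y4 y5 y6 y7 =
  word_comb (x0 + y0) (x1 + y1) (x2 + y2) (x3 + y3) (x4 + y4) (x5 + y5) (x6 + y6)
    (x7 + y7).
Proof. by rewrite !word_combE !scalerDl; do 7!(rewrite addrACA; congr (_ + _)). Qed.

Lemma word_combZ c x0 x1 x2 x3 x4 x5 x6 x7 :
  c *: word_comb x0 x1 x2 x3 x4 x5 x6 x7 =
  word_comb (c * x0) (c * x1) (c * x2) (c * x3) (c * x4) (c * x5) (c * x6) (c * x7).
Proof. by rewrite !word_combE !scalerDr !scalerA. Qed.

Hypothesis rel : D8_relations a b.

Let aa : a * a = 0. Proof. by case: rel. Qed.
Let bb : b * b = 0. Proof. by case: rel. Qed.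
Let baba : b * a * b * a = a * b * a * b.
Proof. by case: rel => _ _ /eqP; rewrite subr_eq0 !expr2 !mulrA => /eqP. Qed.

Lemma mul_a_comb x0 x1 x2 x3 x4 x5 x6 x7 :
  a * word_comb x0 x1 x2 x3 x4 x5 x6 x7 = word_comb 0 x0 0 x2 0 x4 0 x6.
Proof.
rewrite !word_combE !mulrDr -!scalerAr !mulrA aa !mul0r !mulr1 !scaler0 !scale0r.
by rewrite !(addr0, add0r).
Qed.

Lemma mul_b_comb x0 x1 x2 x3 x4 x5 x6 x7 :
  b * word_comb x0 x1 x2 x3 x4 x5 x6 x7 = word_comb 0 0 x0 0 x1 0 x3 x5.
Proof.
rewrite !word_combE !mulrDr -!scalerAr !mulrA bb baba !mul0r !mulr1 !scaler0 !scale0r.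
by rewrite -(mulrA _ b b) bb mulr0 scaler0 !(addr0, add0r).
Qed.

Lemma mul_comb x0 x1 x2 x3 x4 x5 x6 x7 y0 y1 y2 y3 y4 y5 y6 y7 :
  word_comb x0 x1 x2 x3 x4 x5 x6 x7 * word_comb y0 y1 y2 y3 y4 y5 y6 y7 =
  word_comb (x0 * y0) (x0 * y1 + x1 * y0) (x0 * y2 + x2 * y0)
    (x0 * y3 + x1 * y2 + x3 * y0) (x0 * y4 + x2 * y1 + x4 * y0)
    (x0 * y5 + x1 * y4 + x3 * y1 + x5 * y0) (x0 * y6 + x2 * y3 + x4 * y2 + x6 * y0)
    (x0 * y7 + x1 * y6 + x2 * y5 + x3 * y3 + x4 * y4 + x5 * y2 + x6 * y1 + x7 * y0).
Proof.
rewrite {1}word_combE !mulrDl -!scalerAl mul1r -!mulrA !(mul_a_comb, mul_b_comb).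
rewrite !word_combZ !mulr0.
rewrite !word_combD.
by congr word_comb; rewrite !(addr0, add0r).
Qed.

(** Left multiplication by a suitable word moves the lowest surviving coefficient to abab and kills
    all longer words. *)
Lemma word_comb_inj0 x0 x1 x2 x3 x4 x5 x6 x7 : a * b * a * b != 0 ->
  word_comb x0 x1 x2 x3 x4 x5 x6 x7 = 0 ->
  [/\ x0 = 0, x1 = 0, x2 = 0 & [/\ x3 = 0, x4 = 0, x5 = 0, x6 = 0 & x7 = 0]].
Proof.
move=> nz x0E.
have top y : word_comb 0 0 0 0 0 0 0 y = 0 -> y = 0.
  rewrite !word_combE !scale0r !add0r => /eqP.
  by rewrite scaler_eq0 (negPf nz) orbF => /eqP.
have [la lb] : (forall t, t = 0 -> a * t = 0) /\ (forall t, t = 0 -> b * t = 0).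
  by split=> t ->; rewrite mulr0.
have e0 : x0 = 0.
  by have := la _ (lb _ (la _ (lb _ x0E))); rewrite !(mul_a_comb, mul_b_comb) => /top.
rewrite e0 in x0E *.
have e1 : x1 = 0.
  by have := la _ (lb _ (la _ (lb _ x0E))); have := lb _ (la _ (lb _ x0E));
    rewrite !(mul_a_comb, mul_b_comb) => /top.
rewrite e1 in x0E *.
have e2 : x2 = 0.
  by have := la _ (lb _ (la _ x0E)); rewrite !(mul_a_comb, mul_b_comb) => /top.
rewrite e2 in x0E *.
have e3 : x3 = 0.
  by have := la _ (lb _ x0E); rewrite !(mul_a_comb, mul_b_comb) => /top.
have e4 : x4 = 0.
  by have := lb _ (la _ x0E); rewrite !(mul_a_comb, mul_b_comb) => /top.
rewrite e3 e4 in x0E *.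
have e5 : x5 = 0 by have := lb _ x0E; rewrite !(mul_a_comb, mul_b_comb) => /top.
have e6 : x6 = 0 by have := la _ x0E; rewrite !(mul_a_comb, mul_b_comb) => /top.
by rewrite e5 e6 in x0E *; have e7 := top _ x0E.
Qed.

End Words.

Section Presentation.
Variables (k : fieldType) (A : falgType k) (a b : A).
Hypothesis char2 : 2%N \in [pchar k].
Hypothesis presA : D8_presentation a b.

Lemma D8_presentation_sym : D8_presentation b a.
Proof.
have relC (B : algType k) (x y : B) : D8_relations x y -> D8_relations y x.
  by case=> xx yy xy; split=> //; apply/eqP; rewrite -opprB oppr_eq0 xy.
have [rel univ] := presA; split=> [|B x y /relC/univ[[f [fa fb]] uniqf]].
  exact: relC.
by split=> [|g h [ga gb] [ha hb]]; [exists f | apply: uniqf].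
Qed.

(* The regular representation of D8, induced from the four-group: the reflection
   1 + a acts by diag(1 + p, 1 + q) and 1 + b by the swap, over k[p, q]/(p^2, q^2). *)
Lemma abab_neq0 : a * b * a * b != 0.
Proof.
pose N : 'M[k]_2 := delta_mx 0 1.
pose p : 'M[k]_(2 + 2) := block_mx 0 1%:M 0 0.
pose q : 'M[k]_(2 + 2) := block_mx N 0 0 N.
pose x : 'M[k]_(4 + 4) := block_mx p 0 0 q.
pose y : 'M[k]_(4 + 4) := block_mx 1%:M 1%:M 1%:M 1%:M.
have NN : N *m N = 0 by rewrite mul_delta_mx_0.
have addxx n m (M : 'M[k]_(n, m)) : M + M = 0.
  by rewrite -mulr2n -scaler_nat (pcharf0 char2) scale0r.
have pp : p *m p = 0.
  by rewrite mulmx_block !(mulmx0, mul0mx, mulmx1, mul1mx, addr0) -[RHS]block_mx0.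
have qq : q *m q = 0.
  by rewrite mulmx_block !(mulmx0, mul0mx, NN, addr0, add0r) -[RHS]block_mx0.
have pqE : p *m q = block_mx 0 N 0 0.
  by rewrite mulmx_block !(mulmx0, mul0mx, mul1mx, addr0, add0r).
have qpE : q *m p = block_mx 0 N 0 0.
  by rewrite mulmx_block !(mulmx0, mul0mx, mulmx1, addr0, add0r).
pose w := p *m q.
have xx : x *m x = 0.
  by rewrite mulmx_block !(mulmx0, mul0mx, pp, qq, addr0) -[RHS]block_mx0.
have yy : y *m y = 0.
  by rewrite mulmx_block !mulmx1 !addxx -[RHS]block_mx0.
have xyE : x *m y = block_mx p p q q.
  by rewrite mulmx_block !(mulmx1, mul0mx, addr0, add0r).
have yxE : y *m x = block_mx p q p q.
  by rewrite mulmx_block !(mul1mx, mulmx0, addr0, add0r).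
have xyxyE : x *m y *m (x *m y) = block_mx w w w w.
  by rewrite xyE mulmx_block pp qq /w qpE -pqE !(addr0, add0r).
have yxyxE : y *m x *m (y *m x) = block_mx w w w w.
  by rewrite yxE mulmx_block pp qq /w qpE -pqE !(addr0, add0r).
have relxy : @D8_relations k 'M[k]_8 x y.
  by split=> //; apply/eqP; rewrite subr_eq0; apply/eqP; rewrite !expr2; exact: etrans xyxyE (esym yxyxE).
have [_ univ] := presA; have [[f [fa fb]] _] := univ _ _ _ relxy.
apply/eqP => abab0; have xyxy0 : (x : 'M[k]_8) * y * x * y = 0.
  by rewrite -fa -fb -!rmorphM abab0 rmorph0.
rewrite -mulrA in xyxy0.
have : block_mx w w w w = 0 by rewrite -xyxyE; exact: xyxy0.
rewrite -[in RHS](@block_mx0 k 4 4 4 4) => /eq_block_mx[+ _ _ _].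
rewrite /w pqE -[in RHS](@block_mx0 k 2 2 2 2) => /eq_block_mx[_ + _ _].
by move=> /matrixP/(_ 0 1)/eqP; rewrite !mxE !eqxx oner_eq0.
Qed.

(** The combinations of the eight words form a subalgebra U that contains a and b. The map A -> U
    given by the presentation, followed by the inclusion, fixes a and b; by uniqueness it is the
    identity, so U is all of A. *)
Lemma word_span t : exists x0 x1 x2 x3 x4 x5 x6 x7,
  t = word_comb a b x0 x1 x2 x3 x4 x5 x6 x7.
Proof.
have [rel univ] := presA.
pose comb (u : A) := exists x0 x1 x2 x3 x4 x5 x6 x7,
  u = word_comb a b x0 x1 x2 x3 x4 x5 x6 x7.
have comb_lin : lin_closed comb.
  split; first by exists 0, 0, 0, 0, 0, 0, 0, 0; rewrite !word_combE !scale0r !addr0.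
  move=> c u v [x0 [x1 [x2 [x3 [x4 [x5 [x6 [x7 ->]]]]]]]].
  move=> [y0 [y1 [y2 [y3 [y4 [y5 [y6 [y7 ->]]]]]]]].
  by rewrite word_combZ word_combD; do 8!eexists.
have comb_mul u v : comb u -> comb v -> comb (u * v).
  move=> [x0 [x1 [x2 [x3 [x4 [x5 [x6 [x7 ->]]]]]]]].
  move=> [y0 [y1 [y2 [y3 [y4 [y5 [y6 [y7 ->]]]]]]]].
  by rewrite (mul_comb rel); do 8!eexists.
have comb1 : comb 1.
  by exists 1, 0, 0, 0, 0, 0, 0, 0; rewrite !word_combE !scale0r !addr0 scale1r.
have comba : comb a.
  exists 0, 1, 0, 0, 0, 0, 0, 0.
  by rewrite !word_combE !scale0r !addr0 add0r scale1r.
have combb : comb b.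
  exists 0, 0, 1, 0, 0, 0, 0, 0.
  by rewrite !word_combE !scale0r !addr0 !add0r scale1r.
pose U := vspace_of comb_lin.
have U1 : 1 \in U by apply/mem_vspace_of.
have Ualg : is_aspace U.
  rewrite /is_aspace has_algid1 //=; apply/prodvP => u v Uu Uv.
  by apply/mem_vspace_of/comb_mul; apply/(mem_vspace_of comb_lin).
pose UA := ASpace Ualg.
have algid1 : algid UA = 1 by apply/eqP; rewrite algid_eq1.
have Ua : a \in UA by apply/mem_vspace_of.
have Ub : b \in UA by apply/mem_vspace_of.
have relU : D8_relations (Subvs Ua : subvs_of UA) (Subvs Ub).
  by case: rel => aa bb ab; split; apply: val_inj.
have [[f [fa fb]] _] := univ _ _ _ relU.
pose g (u : A) : A := vsval (f u).
have glin : linear g by move=> c u v; rewrite /g !linearP.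
have gmul : monoid_morphism g.
  by split=> [|u v]; rewrite /g ?rmorph1 ?rmorphM //= algid1.
pose gl := GRing.isLinear.Build k A A *:%R g glin.
pose gm := GRing.isMonoidMorphism.Build A A g gmul.
pose G : {lrmorphism A -> A} := HB.pack g gl gm.
have [_ uniqf] := univ _ _ _ rel.
have <- : g t = t.
  by apply: (uniqf G idfun) => //; rewrite /= /g fa fb.
exact/(mem_vspace_of comb_lin)/(subvsP (f t)).
Qed.

End Presentation.

(** * Coordinates, local structure and radical of A *)

Section Coordinates.
Variables (k : fieldType) (A : falgType k) (a b : A).

Definition words : 8.-tuple A :=
  [tuple 1; a; b; a * b; b * a; a * b * a; b * a * b; a * b * a * b].

(** Natural numbers serve as indices; [inord] reads every index above 7 as 0, whence the bounds i <
    8 below. *)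
Definition dco (i : nat) (t : A) : k := coord words (inord i) t.

Lemma dcoD i t u : dco i (t + u) = dco i t + dco i u. Proof. exact: linearD. Qed.
Lemma dcoZ i c t : dco i (c *: t) = c * dco i t. Proof. exact: linearZ. Qed.
Lemma dco0 i : dco i 0 = 0. Proof. exact: linear0. Qed.
Lemma dco_linear i : linear (dco i : A -> k^o).
Proof. by move=> c t u; rewrite dcoD dcoZ. Qed.

Hypothesis char2 : 2%N \in [pchar k].
Hypothesis presA : D8_presentation a b.

Let rel : D8_relations a b. Proof. by case: presA. Qed.

Lemma addxx (V : lmodType k) (v : V) : v + v = 0.
Proof. by rewrite -mulr2n -scaler_nat (pcharf0 char2) scale0r. Qed.

Lemma word_comb_words (c : nat -> k) :
  \sum_(i < 8) c i *: words`_i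
  = word_comb a b (c 0%N) (c 1%N) (c 2%N) (c 3%N) (c 4%N) (c 5%N) (c 6%N) (c 7%N).
Proof. by rewrite !big_ord_recl big_ord0 word_combE addr0 !addrA. Qed.

Lemma words_free : free words.
Proof.
apply/freeP => c cw0 i; pose c' n := c (inord n).
have := word_comb_words c'; under eq_bigr => j _ do rewrite /c' inord_val.
rewrite cw0 => /esym/(word_comb_inj0 rel (abab_neq0 char2 presA)).
rewrite -(inord_val i) -/(c' i).
by case: i => [[|[|[|[|[|[|[|[|//]]]]]]]] ?] [? ? ? [? ? ? ? ?]].
Qed.

Lemma dco_comb x0 x1 x2 x3 x4 x5 x6 x7 i : (i < 8)%N ->
  dco i (word_comb a b x0 x1 x2 x3 x4 x5 x6 x7)
  = nth 0 [:: x0; x1; x2; x3; x4; x5; x6; x7] i.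
Proof.
move=> lti; rewrite -(word_comb_words (nth 0 [:: x0; x1; x2; x3; x4; x5; x6; x7])).
by rewrite /dco coord_sum_free ?words_free // inordK.
Qed.

Lemma dcoE t : t = word_comb a b (dco 0 t) (dco 1 t) (dco 2 t) (dco 3 t) (dco 4 t)
  (dco 5 t) (dco 6 t) (dco 7 t).
Proof.
have [x0 [x1 [x2 [x3 [x4 [x5 [x6 [x7 ->]]]]]]]] := word_span presA t.
by rewrite !dco_comb.
Qed.

Lemma dco_ext t u : (forall i, (i < 8)%N -> dco i t = dco i u) -> t = u.
Proof. by move=> tu; rewrite (dcoE t) (dcoE u) !tu. Qed.

Lemma dco_1 i : (i < 8)%N -> dco i 1 = (i == 0%N)%:R.
Proof.
have -> : 1 = word_comb a b 1 0 0 0 0 0 0 0.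
  by rewrite word_combE !scale0r !addr0 scale1r.
by move=> lti; rewrite dco_comb //; case: i lti => [|[|[|[|[|[|[|[|]]]]]]]].
Qed.
Lemma dco_a i : (i < 8)%N -> dco i a = (i == 1%N)%:R.
Proof.
have -> : a = word_comb a b 0 1 0 0 0 0 0 0.
  by rewrite word_combE !scale0r !addr0 add0r scale1r.
by move=> lti; rewrite dco_comb //; case: i lti => [|[|[|[|[|[|[|[|]]]]]]]].
Qed.
Lemma dco_b i : (i < 8)%N -> dco i b = (i == 2%N)%:R.
Proof.
have -> : b = word_comb a b 0 0 1 0 0 0 0 0.
  by rewrite word_combE !scale0r !addr0 !add0r scale1r.
by move=> lti; rewrite dco_comb //; case: i lti => [|[|[|[|[|[|[|[|]]]]]]]].
Qed.

Section Products.
Variables t u : A.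

Lemma dcoM0 : dco 0 (t * u) = dco 0 t * dco 0 u. Proof. by rewrite {1}(dcoE t) {1}(dcoE u) (mul_comb rel) dco_comb. Qed.
Lemma dcoM1 : dco 1 (t * u) = dco 0 t * dco 1 u + dco 1 t * dco 0 u.
Proof. by rewrite {1}(dcoE t) {1}(dcoE u) (mul_comb rel) dco_comb. Qed.
Lemma dcoM2 : dco 2 (t * u) = dco 0 t * dco 2 u + dco 2 t * dco 0 u.
Proof. by rewrite {1}(dcoE t) {1}(dcoE u) (mul_comb rel) dco_comb. Qed.
Lemma dcoM3 : dco 3 (t * u) = dco 0 t * dco 3 u + dco 1 t * dco 2 u + dco 3 t * dco 0 u.
Proof. by rewrite {1}(dcoE t) {1}(dcoE u) (mul_comb rel) dco_comb. Qed.
Lemma dcoM4 : dco 4 (t * u) = dco 0 t * dco 4 u + dco 2 t * dco 1 u + dco 4 t * dco 0 u.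
Proof. by rewrite {1}(dcoE t) {1}(dcoE u) (mul_comb rel) dco_comb. Qed.
Lemma dcoM5 : dco 5 (t * u) = dco 0 t * dco 5 u + dco 1 t * dco 4 u
  + dco 3 t * dco 1 u + dco 5 t * dco 0 u.
Proof. by rewrite {1}(dcoE t) {1}(dcoE u) (mul_comb rel) dco_comb. Qed.
Lemma dcoM6 : dco 6 (t * u) = dco 0 t * dco 6 u + dco 2 t * dco 3 u
  + dco 4 t * dco 2 u + dco 6 t * dco 0 u.
Proof. by rewrite {1}(dcoE t) {1}(dcoE u) (mul_comb rel) dco_comb. Qed.
Lemma dcoM7 : dco 7 (t * u) = dco 0 t * dco 7 u + dco 1 t * dco 6 u + dco 2 t * dco 5 u
  + dco 3 t * dco 3 u + dco 4 t * dco 4 u + dco 5 t * dco 2 u + dco 6 t * dco 1 u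
  + dco 7 t * dco 0 u.
Proof. by rewrite {1}(dcoE t) {1}(dcoE u) (mul_comb rel) dco_comb. Qed.

End Products.

Definition dcoM := (dcoM0, dcoM1, dcoM2, dcoM3, dcoM4, dcoM5, dcoM6, dcoM7).

(* In characteristic 2 the eighth power map of A is t |-> (dco 0 t)^8. *)
Lemma exp8_scalar t : t * t * (t * t) * (t * t * (t * t)) = (dco 0 t ^+ 8) *: 1.
Proof.
have xx (c : k) : c + c = 0 := @addxx k^o c.
set s := t * t; set r := s * s.
have s1 : dco 1 s = 0 by rewrite dcoM [X in X + _]mulrC xx.
have s2 : dco 2 s = 0 by rewrite dcoM [X in X + _]mulrC xx.
have r0 : dco 0 r = dco 0 t ^+ 4 by rewrite !dcoM -!expr2 -exprM.
have r1 : dco 1 r = 0 by rewrite dcoM s1 !(mulr0, mul0r, addr0).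
have r2 : dco 2 r = 0 by rewrite dcoM s2 !(mulr0, mul0r, addr0).
have r3 : dco 3 r = 0 by rewrite dcoM s1 mul0r addr0 mulrC xx.
have r4 : dco 4 r = 0 by rewrite dcoM s2 mul0r addr0 mulrC xx.
have r5 : dco 5 r = 0 by rewrite dcoM s1 !(mulr0, mul0r) !addr0 mulrC xx.
have r6 : dco 6 r = 0 by rewrite dcoM s2 !(mulr0, mul0r) !addr0 mulrC xx.
apply: dco_ext => -[|[|[|[|[|[|[|[|//]]]]]]]] _; rewrite dcoZ dco_1 //= dcoM ?r0 ?r1 ?r2 ?r3 ?r4 ?r5 ?r6;
  rewrite ?(mulr0, mul0r, addr0, add0r, mulr1) -?exprD //.
by rewrite [X in X + _]mulrC xx.
Qed.

Local Notation J := (jacobson_radical A).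

(** A is local: an element outside the augmentation ideal has a nonzero scalar as its eighth power,
    so it generates A as a left ideal. *)
Lemma maximal_left_idealE (L : {vspace A}) :
  maximal_left_ideal L <-> forall t, t \in L = (dco 0 t == 0).
Proof.
pose I : {vspace A} := lker (lin_hom (dco_linear 0)).
have memI t : (t \in I) = (dco 0 t == 0) by rewrite memv_ker lin_homE.
have subI : @submodule k A (reg_lmodule A) I.
  by move=> u t; rewrite !memI /= dcoM => /eqP ->; rewrite mulr0.
have nI : I != fullv.
  apply/eqP => If; have := memvf (1 : A).
  by rewrite -If memI dco_1 // oner_eq0.
have LI L' : @submodule k A (reg_lmodule A) L' -> L' != fullv -> (L' <= I)%VS.
  move=> subL nL; apply/subvP => t Lt; rewrite memI; apply: contraNT nL => t0.
  apply/eqP/vspaceP => u; rewrite memvf.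
  have e8 : (dco 0 t ^- 8 *: u) * ((dco 0 t ^+ 8) *: 1) = u.
    by rewrite -scalerAr mulr1 scalerA divff ?scale1r // expf_neq0.
  by rewrite -e8 -exp8_scalar !mulrA; apply: subL Lt.
split=> [[subL nL maxL] t | LE].
  have [IL | If] := maxL _ subI (LI _ subL nL); first by rewrite -memI IL.
  by rewrite If eqxx in nI.
have -> : L = I by apply/vspaceP => t; rewrite LE memI.
split=> // L' subL' IL'; have [-> | nL'] := eqVneq L' fullv; first by right.
by left; apply/eqP; rewrite eqEsubv IL' LI.
Qed.

Lemma mem_radical t : (t \in J) = (dco 0 t == 0).
Proof.
pose I : {vspace A} := lker (lin_hom (dco_linear 0)).
have memI u : (u \in I) = (dco 0 u == 0) by rewrite memv_ker lin_homE.
apply/idP/idP => [/mem_vspace_of/(_ I) | t0].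
  by rewrite memI; apply; apply/maximal_left_idealE.
by apply/mem_vspace_of => L /maximal_left_idealE ->.
Qed.

(** A product of two elements of J^2 involves only words of length at least 4, of which abab alone
    survives. The seven tested coordinates are those of the shorter words. *)
Lemma mem_radical4 t : (t \in (J ^+ 4)%VS) = [forall i : 'I_7, dco i t == 0].
Proof.
have low2 : (J ^+ 2 <= lker (lin_hom (dco_linear 0)) :&: (lker (lin_hom (dco_linear 1))
    :&: lker (lin_hom (dco_linear 2))))%VS.
  rewrite expvSl expv1; apply/prodvP => u v; rewrite !mem_radical => /eqP u0 /eqP v0.
  rewrite !memv_cap !memv_ker !lin_homE !dcoM u0 v0.
  by rewrite !(mulr0, mul0r, addr0) eqxx.
have low2E u : u \in (J ^+ 2)%VS -> [/\ dco 0 u = 0, dco 1 u = 0 & dco 2 u = 0].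
  move=> /(subvP low2); rewrite !memv_cap !memv_ker !lin_homE.
  by move=> /and3P[/eqP ? /eqP ? /eqP ?].
apply/idP/forallP => [t4 i | t0].
  pose U := (\bigcap_(i < 7) lker (lin_hom (dco_linear i)))%VS.
  suff /subvP/(_ t t4) : (J ^+ 4 <= U)%VS.
    by rewrite memvE => /subv_bigcapP/(_ i isT); rewrite -memvE memv_ker lin_homE.
  rewrite (expvD _ 2 2); apply/prodvP => u v /low2E[u0 u1 u2] /low2E[v0 v1 v2].
  rewrite memvE; apply/subv_bigcapP => {}i _; rewrite -memvE memv_ker lin_homE.
  by case: i => [[|[|[|[|[|[|[|//]]]]]]] ?] /=; rewrite dcoM ?u0 ?u1 ?u2 ?v0 ?v1 ?v2
    !(mulr0, mul0r, addr0).
have -> : t = dco 7 t *: (a * (b * (a * b))).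
  rewrite [LHS]dcoE; have t0' i (lti : (i < 7)%N) := eqP (t0 (Ordinal lti)).
  rewrite (t0' 0%N isT) (t0' 1%N isT) (t0' 2%N isT) (t0' 3%N isT) (t0' 4%N isT).
  by rewrite (t0' 5%N isT) (t0' 6%N isT) word_combE !scale0r !add0r !mulrA.
have Ja : a \in J by rewrite mem_radical dco_a.
have Jb : b \in J by rewrite mem_radical dco_b.
by rewrite memvZ // 3!expvSl expv1 !memv_mul.
Qed.

End Coordinates.

(** * Modules over A *)

Section Actions.
Variables (k : fieldType) (A : falgType k) (M : lmodule A).
Implicit Types (t u : A) (x y : M).

Lemma lact0r t : lact t (0 : M) = 0.
Proof. exact: linear_prop0 (lact_linearr t). Qed.
Lemma lactDr t x y : lact t (x + y) = lact t x + lact t y.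
Proof. exact: (linear_propD (lact_linearr t) x y). Qed.
Lemma lactZr t c x : lact t (c *: x) = c *: lact t x.
Proof. exact: (linear_propZ (lact_linearr t) c x). Qed.
Lemma lact0l x : lact 0 x = 0.
Proof. exact: (linear_prop0 (lact_linearl x)). Qed.
Lemma lactDl t u x : lact (t + u) x = lact t x + lact u x.
Proof. exact: (linear_propD (lact_linearl x) t u). Qed.
Lemma lactZl t c x : lact (c *: t) x = c *: lact t x.
Proof. exact: (linear_propZ (lact_linearl x) c t). Qed.

Definition cyclic_vs x : {vspace M} := limg (lin_hom (lact_linearl x)).

Lemma mem_cyclic t x : lact t x \in cyclic_vs x.
Proof. by rewrite -(lin_homE (lact_linearl x) t) memv_img ?memvf. Qed.

Lemma cyclicP x y : y \in cyclic_vs x -> exists t, y = lact t x.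
Proof. by move=> /memv_imgP[t _ ->]; exists t; rewrite lin_homE. Qed.

Lemma cyclic_submodule x : submodule (cyclic_vs x).
Proof. by move=> t y /cyclicP[u ->]; rewrite -lactM mem_cyclic. Qed.

End Actions.

Section D8Modules.
Variables (k : fieldType) (A : falgType k) (a b : A).
Hypothesis char2 : 2%N \in [pchar k].
Hypothesis presA : D8_presentation a b.

Lemma aa0 : a * a = 0. Proof. by case: presA => -[]. Qed.
Lemma bb0 : b * b = 0. Proof. by case: presA => -[]. Qed.
Lemma babaE : b * a * b * a = a * b * a * b.
Proof.
by case: presA => -[_ _ /eqP]; rewrite subr_eq0 !expr2 !mulrA => /eqP.
Qed.

Lemma lact_aa (M : lmodule A) (x : M) : lact a (lact a x) = 0.
Proof. by rewrite -lactM aa0 lact0l. Qed.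
Lemma lact_bb (M : lmodule A) (x : M) : lact b (lact b x) = 0.
Proof. by rewrite -lactM bb0 lact0l. Qed.

Lemma lact_words (M : lmodule A) (t : A) (x : M) :
  lact t x = dco a b 0 t *: x + dco a b 1 t *: lact a x + dco a b 2 t *: lact b x
    + dco a b 3 t *: lact a (lact b x) + dco a b 4 t *: lact b (lact a x)
    + dco a b 5 t *: lact a (lact b (lact a x))
    + dco a b 6 t *: lact b (lact a (lact b x))
    + dco a b 7 t *: lact a (lact b (lact a (lact b x))).
Proof. by rewrite {1}(dcoE char2 presA t) word_combE !lactDl !lactZl lact1 !lactM. Qed.

(** The submodule aS + bS is 0 or S. In the second case a z = a b u and b z = b a u can be iterated
    until a word of length 6 appears, which acts as 0; then a and b act as 0 and S = aS + bS is
    0. *)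
Lemma simple_module_line (S : lmodule A) : simple_module S ->
  exists2 y : S, [/\ y != 0, lact a y = 0 & lact b y = 0] & forall z, exists c, z = c *: y.
Proof.
move=> [nzS simS].
pose U := (limg (lin_hom (@lact_linearr _ _ S a)) + limg (lin_hom (@lact_linearr _ _ S b)))%VS.
have memU (z : S) : z \in U -> exists u v, z = lact a u + lact b v.
  move=> /memv_addP[_ /memv_imgP[u _ ->] [_ /memv_imgP[v _ ->] ->]].
  by exists u, v; rewrite !lin_homE.
have Uab (u v : S) : lact a u + lact b v \in U.
  apply: memv_add.
    by rewrite -(lin_homE (@lact_linearr _ _ S a) u) memv_img ?memvf.
  by rewrite -(lin_homE (@lact_linearr _ _ S b) v) memv_img ?memvf.
have subU : submodule U.
  have Ua z : lact a z \in U by have := Uab z 0; rewrite lact0r addr0.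
  have Ub z : lact b z \in U by have := Uab 0 z; rewrite lact0r add0r.
  by move=> t z Uz; rewrite lact_words !rpredD ?rpredZ.
have U0 : U = 0%VS.
  have [//|Uf] := simS _ subU.
  have full (z : S) : exists u v, z = lact a u + lact b v by apply: memU; rewrite Uf memvf.
  have aS (z : S) : exists u, lact a z = lact a (lact b u).
    by have [u [v ->]] := full z; exists v; rewrite lactDr lact_aa add0r.
  have bS (z : S) : exists u, lact b z = lact b (lact a u).
    by have [u [v ->]] := full z; exists u; rewrite lactDr lact_bb addr0.
  have long (z : S) : lact b (lact a (lact b (lact a (lact b z)))) = 0.
    by rewrite -!lactM ?mulrA babaE -!mulrA bb0 !mulr0 lact0l.
  have a0 (z : S) : lact a z = 0.
    have [u1 ->] := aS z; have [u2 ->] := bS u1; have [u3 ->] := aS u2.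
    have [u4 ->] := bS u3; have [u5 ->] := aS u4.
    by rewrite long lact0r.
  have b0 (z : S) : lact b z = 0 by have [u ->] := bS z; rewrite a0 lact0r.
  have /eqP[] := nzS; apply/eqP; rewrite -subv0; apply/subvP => z _.
  by have [u [v ->]] := full z; rewrite a0 b0 addr0 mem0v.
have a0 (z : S) : lact a z = 0.
  by have := Uab z 0; rewrite U0 lact0r addr0 memv0 => /eqP.
have b0 (z : S) : lact b z = 0.
  by have := Uab 0 z; rewrite U0 lact0r add0r memv0 => /eqP.
have [y nzy] : exists y : S, y != 0.
  exists (vpick fullv); apply: contra nzS; rewrite vpick0 //.
exists y; first by split.
have : cyclic_vs y = fullv.
  have [y0|//] := simS _ (@cyclic_submodule _ _ S y).
  by have := mem_cyclic 1 y; rewrite y0 lact1 memv0 (negPf nzy).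
move=> yf z; have := memvf z; rewrite -yf => /cyclicP[t ->].
by exists (dco a b 0 t); rewrite lact_words !(a0, b0) !scaler0 !addr0.
Qed.

(** The shape of the submodule generated by the class of a in rad A / rad^4 A, with top x0 and socle
    a b x0. *)
Definition uniserial3 (X : lmodule A) (x0 : X) : Prop :=
  [/\ lact a x0 = 0, lact b (lact a (lact b x0)) = 0, lact a (lact b x0) != 0
    & forall x, exists c0 c1 c2, x = c0 *: x0 + c1 *: lact b x0 + c2 *: lact a (lact b x0)].

Definition biuniserial (R : lmodule A) (r1 r2 : R) : Prop :=
  [/\ lact a r1 = 0, lact b (lact a (lact b r1)) = 0,
      lact b r2 = 0, lact a (lact b (lact a r2)) = 0
    & (forall r, exists c0 c1 c2 d0 d1 d2,
        r = c0 *: r1 + c1 *: lact b r1 + c2 *: lact a (lact b r1)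
          + (d0 *: r2 + d1 *: lact a r2 + d2 *: lact b (lact a r2))) /\
      (forall c0 c1 c2 d0 d1 d2,
        c0 *: r1 + c1 *: lact b r1 + c2 *: lact a (lact b r1)
          + (d0 *: r2 + d1 *: lact a r2 + d2 *: lact b (lact a r2)) = 0 ->
        [/\ c0 = 0, c1 = 0 & c2 = 0] /\ [/\ d0 = 0, d1 = 0 & d2 = 0])].

Lemma rad_biuniserial : exists r1 r2 : rad_mod_rad4 A, biuniserial r1 r2.
Proof.
pose J := jacobson_radical A.
pose rad4 := rad4_in_rad A.
pose cls (t : A) : rad_mod_rad4 A := quot_pi rad4 (vsproj (J ^+ 1)%VS t).
have memJ t : (t \in (J ^+ 1)%VS) = (dco a b 0 t == 0).
  by rewrite expv1 (mem_radical char2 presA).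
have cls_lin : linear cls by move=> c t u; rewrite /cls !linearP.
have clsD := linear_propD cls_lin; have clsZ := linear_propZ cls_lin.
have act_cls u t : t \in (J ^+ 1)%VS -> lact u (cls t) = cls (u * t).
  move=> Jt; rewrite /cls [LHS](quot_actE (@rad4_in_rad_submodule k A)).
  congr (quot_pi _ _); apply: val_inj.
  rewrite /= (sub_actE (@radX_submodule k A 0)) !vsprojK //.
  exact: (@radX_submodule k A 0) Jt.
have cls0 t : t \in (J ^+ 1)%VS -> cls t = 0 <-> t \in (J ^+ 4)%VS.
  move=> Jt; split=> [/eqP|Jt4]; last (apply/eqP; move: Jt4);
    by rewrite quot_pi_eq0 -memv_preim lfunE /= vsprojK.
have Ja : a \in (J ^+ 1)%VS by rewrite memJ (dco_a char2 presA).
have Jb : b \in (J ^+ 1)%VS by rewrite memJ (dco_b char2 presA).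
have Jl t u : u \in (J ^+ 1)%VS -> t * u \in (J ^+ 1)%VS.
  exact: (@radX_submodule k A 0).
have abab0 c : cls (c *: (a * b * a * b)) = 0.
  apply/cls0; first by rewrite memvZ // Jl.
  rewrite (mem_radical4 char2 presA); apply/forallP => i.
  have -> : c *: (a * b * a * b) = word_comb a b 0 0 0 0 0 0 0 c.
    by rewrite word_combE !scale0r !add0r.
  by rewrite (dco_comb char2 presA) ?(leq_trans (ltn_ord i)) //;
     case: i => [[|[|[|[|[|[|[|//]]]]]]] ?].
have r1E t : lact t (cls a) = cls (t * a) by apply: act_cls.
have r2E t : lact t (cls b) = cls (t * b) by apply: act_cls.
have combE c0 c1 c2 d0 d1 d2 :
    c0 *: cls a + c1 *: lact b (cls a) + c2 *: lact a (lact b (cls a))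
      + (d0 *: cls b + d1 *: lact a (cls b) + d2 *: lact b (lact a (cls b)))
    = cls (word_comb a b 0 c0 d0 d1 c1 c2 d2 0).
  rewrite -!lactM !r1E !r2E -!clsZ -!clsD; congr cls.
  rewrite word_combE !scale0r add0r addr0.
  set u0 := c0 *: a; set u1 := c1 *: _; set u2 := c2 *: _.
  set v0 := d0 *: b; set v1 := d1 *: _; set v2 := d2 *: _.
  rewrite !addrA; congr (_ + _); rewrite -!addrA; congr (_ + _).
  by rewrite addrC -!addrA [u2 + _]addrC -!addrA; congr (_ + (_ + _)); rewrite addrC.
exists (cls a), (cls b); split.
- by rewrite r1E aa0 (linear_prop0 cls_lin).
- by rewrite -!lactM r1E ?mulrA babaE -[a * b * a * b]scale1r abab0.
- by rewrite r2E bb0 (linear_prop0 cls_lin).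
- by rewrite -!lactM r2E ?mulrA -[a * b * a * b]scale1r abab0.
split=> [r|c0 c1 c2 d0 d1 d2].
  rewrite -[r]quot_reprK; set s : subvs_of (J ^+ 1)%VS := quot_repr r.
  have Js : vsval s \in (J ^+ 1)%VS := subvsP s.
  have -> : quot_pi rad4 s = cls (vsval s) by rewrite /cls vsvalK.
  have s0 : dco a b 0 (vsval s) = 0 by apply/eqP; rewrite -memJ.
  do 6!eexists; rewrite combE.
  rewrite {1}(dcoE char2 presA (vsval s)) s0.
  set x1 := dco a b 1 _; set x2 := dco a b 2 _; set x3 := dco a b 3 _.
  set x4 := dco a b 4 _; set x5 := dco a b 5 _; set x6 := dco a b 6 _.
  have -> : word_comb a b 0 x1 x2 x3 x4 x5 x6 (dco a b 7 (vsval s)) =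
      word_comb a b 0 x1 x2 x3 x4 x5 x6 0 + dco a b 7 (vsval s) *: (a * b * a * b).
    by rewrite !word_combE !scale0r addr0.
  by rewrite clsD abab0 addr0.
rewrite combE => /cls0; rewrite memJ (dco_comb char2 presA) //= eqxx => /(_ isT).
rewrite (mem_radical4 char2 presA) => /forallP H.
have H' i (lti : (i < 7)%N) := eqP (H (Ordinal lti)).
have := (H' 1%N isT, H' 2%N isT, H' 3%N isT, H' 4%N isT, H' 5%N isT, H' 6%N isT).
by rewrite !(dco_comb char2 presA) //= => -[[[[[-> ->] ->] ->] ->] ->].
Qed.

End D8Modules.

(** * Indecomposable summands of rad A / rad^4 A *)

Section Summands.
Variables (k : fieldType) (A : falgType k).
Variables (R X : lmodule A) (pi : 'Hom(R, X)) (iota : 'Hom(X, R)).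
Hypotheses (hpi : lmod_hom pi) (hiota : lmod_hom iota).
Hypothesis piK : forall x, pi (iota x) = x.

Lemma biuniserial_sym (a b : A) (r1 r2 : R) : biuniserial a b r1 r2 -> biuniserial b a r2 r1.
Proof.
move=> [ar1 bab1 br2 aba2 [span indep]]; split=> //; split=> [r | c0 c1 c2 d0 d1 d2].
  have [c0 [c1 [c2 [d0 [d1 [d2 ->]]]]]] := span r.
  by exists d0, d1, d2, c0, c1, c2; rewrite addrC.
by rewrite addrC => /indep[].
Qed.

Section Generators.
Variables (a b : A) (r1 r2 : R).
Hypotheses (aa : a * a = 0) (bb : b * b = 0) (bi : biuniserial a b r1 r2).
Local Notation x1 := (pi r1).
Local Notation x2 := (pi r2).

Let ar1 : lact a r1 = 0. Proof. by case: bi. Qed.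
Let bab1 : lact b (lact a (lact b r1)) = 0. Proof. by case: bi. Qed.
Let br2 : lact b r2 = 0. Proof. by case: bi. Qed.
Let aba2 : lact a (lact b (lact a r2)) = 0. Proof. by case: bi. Qed.
Let Laa (M : lmodule A) (x : M) : lact a (lact a x) = 0.
Proof. by rewrite -lactM aa lact0l. Qed.
Let Lbb (M : lmodule A) (x : M) : lact b (lact b x) = 0.
Proof. by rewrite -lactM bb lact0l. Qed.
Let simpl_act := (lactDr, lactZr, Laa, Lbb, ar1, bab1, br2, aba2, lact0r, scaler0, addr0,
  add0r).
Let ax1 : lact a x1 = 0. Proof. by rewrite -hpi ar1 linear0. Qed.
Let bab1' : lact b (lact a (lact b x1)) = 0. Proof. by rewrite -!hpi bab1 linear0. Qed.
Let bx2 : lact b x2 = 0. Proof. by rewrite -hpi br2 linear0. Qed.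
Let aba2' : lact a (lact b (lact a x2)) = 0. Proof. by rewrite -!hpi aba2 linear0. Qed.
Let simpl_act' := (lactDr, lactZr, Laa, Lbb, ax1, bab1', bx2, aba2', lact0r, scaler0, addr0,
  add0r).

(** Since a kills r1, it kills the image of r1 under the idempotent. On the basis of R it kills no
    combination in which b r1 or r2 has a nonzero coefficient. *)
Lemma idempotent_top : exists l c d1 d2,
  iota x1 = l *: r1 + c *: lact a (lact b r1) + d1 *: lact a r2 + d2 *: lact b (lact a r2).
Proof.
have [_ _ _ _ [span indep]] := bi.
have [c0 [c1 [c2 [d0 [d1 [d2 E]]]]]] := span (iota x1).
have : lact a (iota x1) = 0 by rewrite -hiota ax1 linear0.
rewrite E !simpl_act => E0.
have := indep 0 0 c1 0 d0 0; rewrite !scale0r !add0r !addr0 => /(_ E0)[[_ _ c10] [_ d00 _]].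
by exists c0, c2, d1, d2; rewrite c10 d00 !scale0r addr0 add0r !addrA.
Qed.

(** The diagonal entry l of the idempotent is also its eigenvalue at the socle vector a b r1. *)
Lemma socle_top l c d1 d2 :
  iota x1 = l *: r1 + c *: lact a (lact b r1) + d1 *: lact a r2 + d2 *: lact b (lact a r2) ->
  iota (lact a (lact b x1)) = l *: lact a (lact b r1).
Proof. by move=> E; rewrite !hiota E !simpl_act. Qed.

Lemma socle_scale_eq0 l : l *: lact a (lact b r1) = 0 -> l = 0.
Proof.
have [_ _ _ _ [_ indep]] := bi.
by have := indep 0 0 l 0 0 0; rewrite !scale0r !add0r !addr0 => H /H[[]].
Qed.

(** The case where the diagonal entry at r2 is 0. Applying pi expresses x2 through x1 and b a x2;
    multiplying this by a gives a x2 in terms of x1, and b a x2 = 0. So x1 generates X. *)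
Lemma top_vanish c d1 d2 :
  iota x2 = c *: lact b (lact a r2) + d1 *: lact b r1 + d2 *: lact a (lact b r1) ->
  [/\ x2 = d1 *: lact b x1 + d2 *: lact a (lact b x1),
      lact a x2 = d1 *: lact a (lact b x1)
    & forall x, exists c0 c1 c2, x = c0 *: x1 + c1 *: lact b x1 + c2 *: lact a (lact b x1)].
Proof.
move=> E; have x2E' : x2 = c *: lact b (lact a x2) + d1 *: lact b x1
    + d2 *: lact a (lact b x1).
  by rewrite -[LHS]piK E !linearD !linearZ /= !hpi.
have ax2 : lact a x2 = d1 *: lact a (lact b x1) by rewrite {1}x2E' !simpl_act'.
have x2E : x2 = d1 *: lact b x1 + d2 *: lact a (lact b x1).
  by rewrite {1}x2E' ax2 lactZr bab1' !scaler0 add0r.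
split=> // x; have [_ _ _ _ [span _]] := bi.
have [c0 [c1 [c2 [e0 [e1 [e2 rE]]]]]] := span (iota x).
exists c0, (c1 + e0 * d1), (c2 + e0 * d2 + e1 * d1).
rewrite -[LHS]piK rE !linearD !linearZ /= !hpi ax2 [in LHS]x2E lactZr bab1' !scaler0 addr0.
rewrite !scalerDr !scalerA !scalerDl -!addrA; congr (_ + (_ + _)).
by rewrite addrCA.
Qed.

End Generators.

Variables (a b : A) (r1 r2 : R).
Hypothesis char2 : 2%N \in [pchar k].
Hypothesis presA : D8_presentation a b.
Hypothesis bi : biuniserial a b r1 r2.
Hypothesis indecX : indecomposable_module X.

(* Modulo the radical the idempotent iota pi is diagonal in the basis r1, r2, because
   a kills r1 but not r2.  If both diagonal entries are nonzero then pi is injective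
   and X decomposes like R; if both vanish then X = 0. *)
Lemma uniserial_summand :
  (exists x0 : X, uniserial3 a b x0) \/ (exists x0 : X, uniserial3 b a x0).
Proof.
have aa := aa0 presA; have bb := bb0 presA.
have bi' := biuniserial_sym bi.
have [ar1 bab1 br2 aba2 [span indep]] := bi.
have [nzX indX] := indecX.
have X0 : ~ forall x : X, x = 0.
  by move=> x0; case/eqP: nzX; apply/eqP; rewrite -subv0; apply/subvP => x _; rewrite (x0 x) mem0v.
have [l [c [d1 [d2 E1]]]] := idempotent_top aa bi.
have [l' [c' [d1' [d2' E2]]]] := idempotent_top bb bi'.
have s1 := socle_top bb bi E1; have s2 := socle_top aa bi' E2.
have ax1 : lact a (pi r1) = 0 by rewrite -hpi ar1 linear0.
have bx2 : lact b (pi r2) = 0 by rewrite -hpi br2 linear0.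
have bab1' : lact b (lact a (lact b (pi r1))) = 0 by rewrite -!hpi bab1 linear0.
have aba2' : lact a (lact b (lact a (pi r2))) = 0 by rewrite -!hpi aba2 linear0.
have nz1 : l != 0 -> lact a (lact b (pi r1)) != 0.
  apply: contraNneq => ab0; apply/eqP/(socle_scale_eq0 bi).
  by rewrite -s1 ab0 linear0.
have nz2 : l' != 0 -> lact b (lact a (pi r2)) != 0.
  apply: contraNneq => ba0; apply/eqP/(socle_scale_eq0 bi').
  by rewrite -s2 ba0 linear0.
have V2 : l' = 0 -> iota (pi r2) = c' *: lact b (lact a r2) + d1' *: lact b r1
    + d2' *: lact a (lact b r1) by move=> l'0; rewrite E2 l'0 scale0r add0r.
have V1 : l = 0 -> iota (pi r1) = c *: lact a (lact b r1) + d1 *: lact a r2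
    + d2 *: lact b (lact a r2) by move=> l0; rewrite E1 l0 scale0r add0r.
have [l0 | nzl] := eqVneq l 0; have [l'0 | nzl'] := eqVneq l' 0.
- case: X0; have [_ ax2 sp] := top_vanish aa bi (V2 l'0).
  have [x1E _ _] := top_vanish bb bi' (V1 l0).
  have injI x : iota x = 0 -> x = 0 by move=> ix0; rewrite -[x]piK ix0 linear0.
  have ab0 : lact a (lact b (pi r1)) = 0 by apply: injI; rewrite s1 l0 scale0r.
  have x10 : pi r1 = 0 by rewrite x1E ax2 ab0 !(scaler0, lact0r, addr0).
  by move=> x; have [e0 [e1 [e2 ->]]] := sp x; rewrite x10 !lact0r !scaler0 !addr0.
- right; exists (pi r2); split=> //; first exact: nz2.
  by have [_ _] := top_vanish bb bi' (V1 l0).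
- left; exists (pi r1); split=> //; first exact: nz1.
  by have [_ _] := top_vanish aa bi (V2 l'0).
have inj r : pi r = 0 -> r = 0.
  have [e0 [e1 [e2 [f0 [f1 [f2 ->]]]]]] := span r => r0.
  have r0' : e0 *: pi r1 + e1 *: lact b (pi r1) + e2 *: lact a (lact b (pi r1))
      + (f0 *: pi r2 + f1 *: lact a (pi r2) + f2 *: lact b (lact a (pi r2))) = 0.
    by rewrite -r0 !linearD !linearZ /= !hpi.
  have simp := (lactDr, lactZr, lact_aa presA, lact_bb presA, ax1, bab1', bx2, aba2',
    lact0r, scaler0, addr0, add0r).
  have scal0 (x : X) s : x != 0 -> s *: x = 0 -> s = 0.
    by move=> nzx /eqP; rewrite scaler_eq0 (negPf nzx) orbF => /eqP.
  have e00 : e0 = 0.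
    apply: (scal0 _ _ (nz1 nzl)).
    by have := congr1 (fun y : X => lact a (lact b y)) r0'; rewrite !simp.
  have f00 : f0 = 0.
    apply: (scal0 _ _ (nz2 nzl')).
    by have := congr1 (fun y : X => lact b (lact a y)) r0'; rewrite !simp.
  rewrite e00 f00 !scale0r !add0r in r0' *.
  have e10 : e1 = 0.
    by apply: (scal0 _ _ (nz1 nzl)); have := congr1 (lact a) r0'; rewrite !simp.
  have f10 : f1 = 0.
    by apply: (scal0 _ _ (nz2 nzl')); have := congr1 (lact b) r0'; rewrite !simp.
  rewrite e10 f10 !scale0r !add0r in r0' *.
  have := congr1 iota r0'; rewrite linear0 linearD !linearZ /= s1 s2 !scalerA => r0''.
  have := indep 0 0 (e2 * l) 0 0 (f2 * l'); rewrite !scale0r !add0r.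
  move=> /(_ r0'')[[_ _ /eqP e20] [_ _ /eqP f20]].
  rewrite mulf_eq0 (negPf nzl) orbF in e20; rewrite mulf_eq0 (negPf nzl') orbF in f20.
  by rewrite (eqP e20) (eqP f20) !scale0r addr0.
have full : (cyclic_vs (pi r1) + cyclic_vs (pi r2))%VS = fullv.
  apply/vspaceP => x; rewrite memvf.
  have [e0 [e1 [e2 [f0 [f1 [f2 rE]]]]]] := span (iota x).
  rewrite -[x]piK rE linearD /=; apply: memv_add.
    rewrite !linearD !linearZ /= !hpi -lactM -[X in e0 *: X]lact1.
    by rewrite !memvD ?memvZ ?mem_cyclic.
  rewrite !linearD !linearZ /= !hpi -lactM -[X in f0 *: X]lact1.
  by rewrite !memvD ?memvZ ?mem_cyclic.
have cap0 : (cyclic_vs (pi r1) :&: cyclic_vs (pi r2))%VS = 0%VS.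
  apply/eqP; rewrite -subv0; apply/subvP => x; rewrite memv_cap memv0.
  move=> /andP[/cyclicP[t xt] /cyclicP[u xu]].
  have : lact t r1 + lact (- u) r2 = 0.
    apply: inj; rewrite linearD /= !hpi -xt -scaleN1r lactZl -xu scaleN1r subrr //.
  rewrite (lact_words char2 presA t r1) (lact_words char2 presA (- u) r2) ar1 br2.
  rewrite !lact0r bab1 aba2 !lact0r !scaler0 !addr0.
  move=> /indep[[t0 t2 t3] _].
  rewrite xt -hpi (lact_words char2 presA t r1) ar1 !lact0r bab1 !lact0r !scaler0 !addr0.
  by rewrite t0 t2 t3 !scale0r !addr0 linear0.
have [z1 | z2] := indX _ _ (@cyclic_submodule _ _ X (pi r1)) (@cyclic_submodule _ _ X (pi r2)) full cap0.
  have := mem_cyclic (a * b) (pi r1); rewrite z1 memv0 lactM.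
  by rewrite (negPf (nz1 nzl)).
have := mem_cyclic (b * a) (pi r2); rewrite z2 memv0 lactM.
by rewrite (negPf (nz2 nzl')).
Qed.

End Summands.

(** * Centers of trivial extensions and endomorphisms of A (+) M *)

Section TrivialExtensionCenter.
Variables (k : fieldType) (C : falgType k).

Lemma trivext_central (z : center (trivext C)) :
  (forall g, (vsval z).1 * g = g * (vsval z).1) /\
  (forall g h, (vsval z).2 (g * h) = (vsval z).2 (h * g)).
Proof.
split=> [g | g h].
  exact (congr1 (fun u : trivext C => u.1) (centerC z ((g, 0) : trivext C))).
have := congr1 (fun u : trivext C => u.2 h) (centerC z ((g, 0) : trivext C)).
rewrite /= !add_lfunE !dual_lactE !dual_ractE.
by rewrite [X in X + _ = _]lfunE add0r [X in _ = _ + X]lfunE addr0.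
Qed.

Lemma trivext_central_ex (f : C) (phi : 'Hom(C, k^o)) :
  (forall g, f * g = g * f) -> (forall g h, phi (g * h) = phi (h * g)) ->
  exists z : center (trivext C), vsval z = (f, phi) :> trivext C.
Proof.
move=> fC phiC; apply: center_ex => -[g psi]; congr (_, _); rewrite /= ?fC //.
apply/lfunP => h; rewrite !add_lfunE !dual_lactE !dual_ractE addrC phiC; congr (_ + _).
by rewrite fC.
Qed.

End TrivialExtensionCenter.

Section GeneratorEndo.
Variables (k : fieldType) (A : falgType k) (M : lmodule A).
Local Notation E := (reg_dsum_endop M).
Local Notation AM := (dsum_lmodule (reg_lmodule A) M).

Definition efun (f : E) : 'End(AM) := endop_val (f : endop (reg_dsum_neq0 M)).

Lemma efun_inj (f g : E) : efun f =1 efun g -> f = g.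
Proof. by move=> fg; apply: endop_val_inj; apply/lfunP. Qed.

Lemma efunM (f g : E) x : efun (f * g) x = efun g (efun f x).
Proof. by rewrite /efun endop_valM comp_lfunE. Qed.

Lemma efun1 x : efun 1 x = x.
Proof. by rewrite /efun [endop_val 1]endop_oneE id_lfunE. Qed.

Lemma efunD f g x : efun (f + g) x = efun f x + efun g x.
Proof. by rewrite /efun endop_valD add_lfunE. Qed.

Lemma efunZ c f x : efun (c *: f) x = c *: efun f x.
Proof. by rewrite /efun endop_valZ scale_lfunE. Qed.

Lemma efun0 x : efun 0 x = 0.
Proof. by rewrite -(scale0r 0) efunZ scale0r. Qed.

Lemma efun_act (f : E) t (x : AM) : efun f (lact t x) = lact t (efun f x).
Proof. exact: endop_hom. Qed.

Lemma efun_pair (f : E) (t : A) (x : M) :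
  efun f ((t, x) : AM) = lact t (efun f ((1, 0) : AM)) + efun f ((0, x) : AM).
Proof.
rewrite -efun_act -linearD; congr (efun f _).
by congr (_, _); rewrite /= ?mulr1 ?addr0 ?lact0r ?add0r.
Qed.

Definition endo (f : AM -> AM) (lf : linear f) : E :=
  endop_of (reg_dsum_neq0 M) (lin_hom lf).

Lemma endoE (f : AM -> AM) (lf : linear f) :
  (forall t x, f (lact t x) = lact t (f x)) -> efun (endo lf) =1 f.
Proof.
move=> hf x; rewrite /efun endop_ofK ?lin_homE // => t y.
by rewrite !lin_homE.
Qed.

Fact rmul_linear (q : A) : linear (fun x : AM => (x.1 * q, 0) : AM).
Proof.
move=> c x y; congr (_, _); last by rewrite /= scaler0 addr0.
by rewrite /= mulrDl scalerAl.
Qed.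
(** In the opposite endomorphism algebra right multiplications keep the order of products; the one
    by 1 is the idempotent of the summand A. *)
Definition rmul_endo q : E := endo (rmul_linear q).

Lemma rmul_endoE q x : efun (rmul_endo q) x = (x.1 * q, 0).
Proof.
apply: (endoE (rmul_linear q)) => t y.
by congr (_, _); rewrite /= ?mulrA ?lact0r.
Qed.

Lemma rmul_endoM p q : rmul_endo p * rmul_endo q = rmul_endo (p * q).
Proof. by apply: efun_inj => x; rewrite efunM !rmul_endoE /= mulrA. Qed.

Lemma rmul_endo_linear : linear rmul_endo.
Proof.
move=> c p q; apply: efun_inj => x; rewrite efunD efunZ !rmul_endoE.
by congr (_, _); rewrite /= ?scaler0 ?addr0 // mulrDr scalerAr.
Qed.

Fact ev_linear (y : M) : linear (fun x : AM => (0, lact x.1 y) : AM).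
Proof.
move=> c x z; congr (_, _); first by rewrite /= scaler0 addr0.
by rewrite /= lactDl lactZl.
Qed.
Definition ev_endo y : E := endo (ev_linear y).

Lemma ev_endoE y x : efun (ev_endo y) x = (0, lact x.1 y).
Proof.
apply: (endoE (ev_linear y)) => t z.
by congr (_, _); rewrite /= ?mulr0 ?lactM.
Qed.

End GeneratorEndo.

(** * The stable center of T(Lambda) *)

Section SimpleCase.
Variables (k : fieldType) (A : falgType k) (a b : A).
Hypothesis char2 : 2%N \in [pchar k].
Hypothesis presA : D8_presentation a b.
Variables (S : lmodule A) (y0 : S).
Hypothesis y0_neq0 : y0 != 0.
Hypotheses (ay0 : lact a y0 = 0) (by0 : lact b y0 = 0).
Hypothesis S_line : forall z : S, exists c, z = c *: y0.
Local Notation L := (reg_dsum_endop S).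
Local Notation dco := (dco a b).
Local Notation R := (@rmul_endo k A S).

Let xx (c : k) : c + c = 0 := @addxx k char2 k^o c.

Lemma lact_simple t (z : S) : lact t z = dco 0 t *: z.
Proof.
have [c ->] := S_line z; rewrite lactZr (lact_words char2 presA t y0) ay0 by0.
by rewrite !lact0r !scaler0 !addr0 !scalerA mulrC.
Qed.

Lemma mul_abab t : t * (a * b * a * b) = dco 0 t *: (a * b * a * b).
Proof.
have e : a * b * a * b = word_comb a b 0 0 0 0 0 0 0 1.
  by rewrite word_combE !scale0r !add0r scale1r.
rewrite {1}e {1}(dcoE char2 presA t); case: (presA) => rel _.
rewrite (mul_comb rel) !(mulr0, addr0, add0r) mulr1.
by rewrite word_combE !scale0r !add0r.
Qed.

(** Take u with 1 |-> y0 from A to S and v with y0 |-> abab from S to A. First u, then v is right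
    multiplication by abab; first v, then u is the action of abab on S, which is 0. *)
Lemma rmul_abab_commutator : exists u v : L, R (a * b * a * b) = u * v /\ v * u = 0.
Proof.
have l_lin : linear (coord [tuple y0] ord0 : S -> k^o) by move=> c u v; rewrite linearP.
pose l := lin_hom l_lin.
have lE z : z = (l z : k) *: y0.
  have y0z : z \in <<[tuple y0]>>%VS.
    by have [c ->] := S_line z; rewrite memvZ // memv_span // mem_seq1.
  by rewrite {1}(coord_span y0z) big_ord1 lin_homE.
have ly0 : l y0 = 1.
  apply/eqP; have /eqP := lE y0; rewrite -{1}(scale1r y0) -subr_eq0 -scalerBl.
  by rewrite scaler_eq0 (negPf y0_neq0) orbF subr_eq0 eq_sym.
pose v (x : dsum_lmodule (reg_lmodule A) S) : dsum_lmodule (reg_lmodule A) S :=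
  ((l x.2 : k) *: (a * b * a * b), 0).
have v_lin : linear v.
  move=> c x y; congr (_, _); last by rewrite /= scaler0 addr0.
  by rewrite /= linearP scalerDl -scalerA.
have vE : efun (endo v_lin) =1 v.
  apply: endoE => t x; congr (_, _); last by rewrite /= lact0r.
  by rewrite /= lact_simple linearZ -scalerAr mul_abab !scalerA mulrC.
exists (ev_endo y0), (endo v_lin); split; apply: efun_inj => x.
  rewrite efunM rmul_endoE ev_endoE vE; congr (_, _).
  by rewrite /= mul_abab lact_simple linearZ /= ly0 [_ *: (1 : k^o)]mulr1.
rewrite efunM ev_endoE vE efun0 /= lactZl !lactM by0 !lact0r scaler0.
by [].
Qed.

Section TraceForm.
Variable psi : 'Hom(L, k^o).
Hypothesis psiC : forall g h, psi (g * h) = psi (h * g).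

Lemma trace_rmul p q : psi (R (p * q)) = psi (R (q * p)).
Proof. by rewrite -!rmul_endoM psiC. Qed.

Lemma trace_abab : psi (R (a * b * a * b)) = 0.
Proof. by have [u [v [-> vu0]]] := rmul_abab_commutator; rewrite psiC vu0 linear0. Qed.

(** In q m only words of length at least 2 occur, ab and ba with equal coefficients. A trace form
    agrees on ab and ba, which cancel in characteristic 2; it agrees on aba and aab = 0, and on bab
    and bba = 0. *)
Lemma trace_radical_center q m :
  dco 0 m = 0 -> dco 1 m = 0 -> dco 2 m = 0 -> dco 3 m = dco 4 m ->
  psi (R (q * m)) = 0.
Proof.
move=> m0 m1 m2 m34; have RD := linear_propD (@rmul_endo_linear k A S).
have RZ := linear_propZ (@rmul_endo_linear k A S).
have R0 := linear_prop0 (@rmul_endo_linear k A S).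
rewrite (dcoE char2 presA (q * m)) !dcoM // m0 m1 m2 -m34.
rewrite !(mulr0, addr0) word_combE !RD !RZ !linearD !linearZ /= !scale0r !add0r.
rewrite trace_abab (trace_rmul b a) scaler0 addr0 -scalerDl xx scale0r add0r.
rewrite trace_rmul mulrA (aa0 presA) mul0r R0 linear0 scaler0 add0r.
by rewrite trace_rmul mulrA (bb0 presA) mul0r R0 linear0 scaler0.
Qed.

Lemma trace_mul_rmul g m :
  dco 0 m = 0 -> dco 1 m = 0 -> dco 2 m = 0 -> dco 3 m = dco 4 m ->
  psi (g * R m) = 0.
Proof.
move=> m0 m1 m2 m34.
(* By the trace property g may be cut down to the corner of the idempotent [R 1], where it is a
   right multiplication. *)
have -> : R m = R 1 * R m * R 1 by rewrite !rmul_endoM mul1r mulr1.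
rewrite !mulrA psiC !mulrA.
have -> : R 1 * g * R 1 = R (efun g ((1, 0) : dsum_lmodule (reg_lmodule A) S)).1.
  apply: efun_inj => -[t x]; rewrite !efunM !rmul_endoE /= mulr1.
  by rewrite efun_pair linear0 addr0 /= mulr1.
by rewrite rmul_endoM trace_radical_center.
Qed.

End TraceForm.

Definition top_coef (f : L) : k :=
  dco 0 (efun f ((1, 0) : dsum_lmodule (reg_lmodule A) S)).1.

(** Commuting with the right multiplications and with the maps A -> S shows that f is right
    multiplication by a central m on A and the scalar [dco 0 m], that is 0, on S. The remaining
    coordinates are read off from m b = b m and m a = a m. *)
Lemma central_endo (f : L) : (forall g, f * g = g * f) -> top_coef f = 0 ->
  exists2 m, f = R m &
    [/\ dco 0 m = 0, dco 1 m = 0, dco 2 m = 0 & dco 3 m = dco 4 m].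
Proof.
move=> fC f0; set e1 : dsum_lmodule (reg_lmodule A) S := (1, 0).
have fCx g x : efun f (efun g x) = efun g (efun f x) by rewrite -!efunM fC.
set m := (efun f e1).1.
have f1 : efun f e1 = (m, 0).
  by have := fCx (R 1) e1; rewrite !rmul_endoE /= !mulr1.
have mC q : q * m = m * q.
  have := fCx (R q) e1; rewrite !rmul_endoE f1 /= mul1r.
  have -> : ((q, 0) : dsum_lmodule (reg_lmodule A) S) = lact q e1.
    by congr (_, _); rewrite /= ?mulr1 ?lact0r.
  by rewrite efun_act f1 => -[].
have f2 x : efun f ((0, x) : dsum_lmodule (reg_lmodule A) S) = 0.
  have := fCx (ev_endo x) e1; rewrite !ev_endoE f1 /= lact1 => ->.
  by rewrite lact_simple [dco 0 m]f0 scale0r.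
exists m.
  apply: efun_inj => -[t x]; rewrite efun_pair f1 f2 addr0 rmul_endoE.
  by congr (_, _); rewrite /= lact0r.
have ma := mC a; have mb := mC b; split=> //.
- have := congr1 (dco 4) mb; rewrite !dcoM // !dco_b //=.
  by rewrite !(mulr0, mul0r, mul1r, addr0, add0r).
- have := congr1 (dco 3) ma; rewrite !dcoM // !dco_a //=.
  by rewrite !(mulr0, mul0r, mul1r, addr0, add0r).
have := congr1 (dco 5) ma; rewrite !dcoM // !dco_a //=.
by rewrite !(mulr0, mul0r, mul1r, mulr1, addr0, add0r).
Qed.

(** In the first component only abab can occur, with coefficient m3 n3 + m4 n4, which is twice the
    same product. The second component consists of values covered by [trace_mul_rmul]. *)
Lemma radical_center_mul (x y : center (trivext L)) :
  top_coef (vsval x).1 = 0 -> top_coef (vsval y).1 = 0 -> x * y = 0.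
Proof.
have [fxC psixC] := trivext_central x; have [fyC psiyC] := trivext_central y.
move=> /(central_endo fxC)[m xE [m0 m1 m2 m34]].
move=> /(central_endo fyC)[n yE [n0 n1 n2 n34]].
apply: val_inj; congr (_, _).
  rewrite /= xE yE rmul_endoM; have -> : m * n = 0.
    apply: (dco_ext char2 presA) => -[|[|[|[|[|[|[|[|//]]]]]]]] _;
      rewrite dcoM // dco0 ?m0 ?m1 ?m2 ?n0 ?n1 ?n2 ?m34 ?n34;
      by rewrite ?(mulr0, mul0r, addr0, add0r) ?xx.
  exact: (linear_prop0 (@rmul_endo_linear k A S)).
apply/lfunP => g; rewrite add_lfunE dual_lactE dual_ractE lfunE xE yE.
by rewrite (trace_mul_rmul psiyC) // psixC (trace_mul_rmul psixC) // addr0.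
Qed.

(** Write z = c + n with n of augmentation 0. Then z z = c^2, as 2 c n = 0 and n n = 0; so either c
    = 0, or Z^pr contains 1 and is everything. *)
Lemma simple_stable_center (x y : center (trivext L)) :
  x * x \in proj_center _ -> y * y \in proj_center _ -> x * y \in proj_center _.
Proof.
have top1 : top_coef 1 = 1 by rewrite /top_coef efun1 dco_1.
have topD f g : top_coef (f + g) = top_coef f + top_coef g.
  by rewrite /top_coef efunD dcoD.
have topZ c f : top_coef (c *: f) = c * top_coef f.
  by rewrite /top_coef efunZ dcoZ.
have one1 : (vsval (1 : center (trivext L))).1 = 1.
  suff -> : vsval (1 : center (trivext L)) = 1 by [].
  apply/eqP; rewrite algid_eq1 memv_cap memvf; apply/centvP => u _.
  by rewrite mul1r mulr1.
have case z : z * z \in proj_center (trivext L) ->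
    top_coef (vsval z).1 = 0 \/ 1 \in proj_center (trivext L).
  set c := top_coef _.
  have [n n0 zE] : exists2 n : center (trivext L), top_coef (vsval n).1 = 0 & z = c *: 1 + n.
    exists (z - c *: 1); last by rewrite addrC subrK.
    by rewrite /= topD -scaleN1r topZ topZ one1 top1 mulr1 mulN1r subrr.
  have sq : (c *: 1 + n) * (c *: 1 + n) = (c ^+ 2) *: 1.
    rewrite mulrDl !mulrDr (radical_center_mul n0 n0) addr0.
    rewrite -!scalerAl -!scalerAr !mulr1 !mul1r -addrA (addxx char2 (c *: n)) addr0.
    by rewrite scalerA.
  rewrite [in z * z]zE sq.
  have [-> | nzc] := eqVneq c 0; first by left.
  move=> c1; right; have := memvZ (c ^- 2) c1.
  by rewrite scalerA mulVf ?scale1r // expf_neq0.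
have triv : 1 \in proj_center (trivext L) -> x * y \in proj_center (trivext L).
  by move=> /(proj_center_mull (x * y)); rewrite mulr1.
move=> /case[x0|/triv->//] /case[y0'|/triv//].
by rewrite radical_center_mul ?mem0v.
Qed.

End SimpleCase.

(** * A nonzero product in the stable center of T(Gamma) *)

Section UniserialCase.
Variables (k : fieldType) (A : falgType k) (a b : A).
Hypothesis char2 : 2%N \in [pchar k].
Hypothesis presA : D8_presentation a b.
Variables (X : lmodule A) (x0 : X).
Hypothesis uniX : uniserial3 a b x0.
Local Notation G := (reg_dsum_endop X).
Local Notation AX := (dsum_lmodule (reg_lmodule A) X).
Local Notation dco := (dco a b).

Let xx (c : k) : c + c = 0 := @addxx k char2 k^o c.

Definition uni_basis : 3.-tuple X := [tuple x0; lact b x0; lact a (lact b x0)].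
Definition xco (i : nat) (x : X) : k := coord uni_basis (inord i) x.

Lemma xcoD i x y : xco i (x + y) = xco i x + xco i y. Proof. exact: linearD. Qed.
Lemma xcoZ i c x : xco i (c *: x) = c * xco i x. Proof. exact: linearZ. Qed.
Lemma xco0 i : xco i 0 = 0. Proof. exact: linear0. Qed.

Lemma xco_comb c0 c1 c2 i : (i < 3)%N ->
  xco i (c0 *: x0 + c1 *: lact b x0 + c2 *: lact a (lact b x0)) = nth 0 [:: c0; c1; c2] i.
Proof.
have [ax0 bab0 abn0 _] := uniX => lti.
have combE (c : nat -> k) : \sum_(j < 3) c j *: uni_basis`_j
    = c 0%N *: x0 + c 1%N *: lact b x0 + c 2%N *: lact a (lact b x0).
  by rewrite !big_ord_recl big_ord0 addr0 !addrA.
have fr : free uni_basis.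
  apply/freeP => c cw0 j; pose c' n := c (inord n).
  have := combE c'; under eq_bigr => l _ do rewrite /c' inord_val.
  rewrite cw0 => /esym E.
  have scal0 s : s *: lact a (lact b x0) = 0 -> s = 0.
    by move=> /eqP; rewrite scaler_eq0 (negPf abn0) orbF => /eqP.
  have c00 : c' 0%N = 0.
    apply: scal0; have := congr1 (fun x : X => lact a (lact b x)) E.
    by rewrite !(lactDr, lactZr, lact_bb presA, bab0, lact0r, scaler0, addr0).
  have c10 : c' 1%N = 0.
    apply: scal0; have := congr1 (lact a) E.
    by rewrite !(lactDr, lactZr, lact_aa presA, ax0, lact0r, scaler0, addr0, add0r).
  have c20 : c' 2%N = 0 by apply: scal0; rewrite -[RHS]E c00 c10 !scale0r !add0r.
  rewrite -(inord_val j) -/(c' j).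
  by case: j => [[|[|[|//]]] ?].
rewrite -(combE (nth 0 [:: c0; c1; c2])) /xco coord_sum_free //.
by rewrite inordK.
Qed.

(** A linear choice of an element of A that maps x0 to x; with it an endomorphism of A (+) X is
    computed from its values at two generators. *)
Definition xlift (x : X) : A := word_comb a b (xco 0 x) 0 (xco 1 x) (xco 2 x) 0 0 0 0.

Lemma xliftK x : lact (xlift x) x0 = x.
Proof.
have [_ _ _ sp] := uniX; have [c0 [c1 [c2 ->]]] := sp x.
rewrite /xlift !xco_comb //= word_combE !lactDl !lactZl !scale0r !addr0 lact1.
by rewrite !lactM.
Qed.

Lemma xco_gen t i : (i < 3)%N ->
  xco i (lact t x0) = nth 0 [:: dco 0 t; dco 2 t; dco 3 t] i.
Proof.
move=> lti; have [ax0 bab0 _ _] := uniX; rewrite -(xco_comb _ _ _ lti).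
congr (xco i _); rewrite (lact_words char2 presA t x0) ax0 bab0 !lact0r.
by rewrite !scaler0 !addr0.
Qed.

Section Action.
Variables (t : A) (x : X).
Let actE : lact t x = lact (t * xlift x) x0. Proof. by rewrite lactM xliftK. Qed.
Let simp := (mulr0, mul0r, addr0, add0r).

Lemma xco_act0 : xco 0 (lact t x) = dco 0 t * xco 0 x.
Proof. by rewrite actE xco_gen //= dcoM // !dco_comb //= !simp. Qed.
Lemma xco_act1 : xco 1 (lact t x) = dco 0 t * xco 1 x + dco 2 t * xco 0 x.
Proof. by rewrite actE xco_gen //= dcoM // !dco_comb //= !simp. Qed.
Lemma xco_act2 :
  xco 2 (lact t x) = dco 0 t * xco 2 x + dco 1 t * xco 1 x + dco 3 t * xco 0 x.
Proof. by rewrite actE xco_gen //= dcoM // !dco_comb //= !simp. Qed.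
End Action.

Definition xco_act := (xco_act0, xco_act1, xco_act2).

Lemma xco_x0 i : (i < 3)%N -> xco i x0 = (i == 0%N)%:R.
Proof.
move=> lti; rewrite -[x0]lact1 xco_gen // !dco_1 //.
by case: i lti => [|[|[|]]].
Qed.

Definition e1 : AX := (1, 0).
Definition e2 : AX := (0, x0).

Lemma efun_gen (g : G) (y : AX) :
  efun g y = lact y.1 (efun g e1) + lact (xlift y.2) (efun g e2).
Proof.
rewrite -!efun_act -linearD; congr (efun g _); case: y => t x.
by congr (_, _); rewrite /= ?mulr1 ?mulr0 ?addr0 // xliftK lact0r add0r.
Qed.

Lemma efun_gen_ext (f g : G) : efun f e1 = efun g e1 -> efun f e2 = efun g e2 -> f = g.
Proof. by move=> fg1 fg2; apply: efun_inj => y; rewrite (efun_gen f y) (efun_gen g y) fg1 fg2. Qed.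

(** The image of x0 inherits the relations a x0 = 0 and bab x0 = 0. In A this leaves the words ab,
    aba and abab, in X the vectors x0 and a b x0. *)
Lemma efun_e2 (g : G) :
  [/\ dco 0 (efun g e2).1 = 0, dco 1 (efun g e2).1 = 0, dco 2 (efun g e2).1 = 0
    & [/\ dco 4 (efun g e2).1 = 0, dco 6 (efun g e2).1 = 0 & xco 1 (efun g e2).2 = 0]].
Proof.
have [ax0 bab0 _ _] := uniX.
set m := (efun g e2).1; set v := (efun g e2).2.
have efunE0 t : lact t x0 = 0 -> t * m = 0 /\ lact t v = 0.
  move=> tx0; have : lact t (efun g e2) = 0.
    by rewrite -efun_act -(linear0 (efun g)); congr (efun g _); congr (_, _); rewrite /= ?mulr0.
  by case.
have [am av] := efunE0 a ax0.
have [babm _] : b * a * b * m = 0 /\ lact (b * a * b) v = 0.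
  by apply: efunE0; rewrite !lactM.
have simp := (mulr0, mul0r, mul1r, addr0, add0r).
have dca i (lti : (i < 8)%N) := dco_a char2 presA lti.
have ax1 : xco 1 v = 0.
  by have := congr1 (xco 2) av; rewrite xco0 xco_act !dca //= !simp.
have m0 : dco 0 m = 0.
  by have := congr1 (dco 1) am; rewrite dco0 dcoM // !dca //= !simp.
have m2 : dco 2 m = 0.
  by have := congr1 (dco 3) am; rewrite dco0 dcoM // !dca //= !simp.
have m4 : dco 4 m = 0.
  by have := congr1 (dco 5) am; rewrite dco0 dcoM // !dca //= !simp.
have m6 : dco 6 m = 0.
  by have := congr1 (dco 7) am; rewrite dco0 dcoM // !dca //= !simp.
have m1 : dco 1 m = 0.
  have babE : b * a * b = word_comb a b 0 0 0 0 0 0 1 0.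
    by rewrite word_combE !scale0r !add0r addr0 scale1r.
  have := congr1 (dco 7) babm.
  by rewrite dco0 babE dcoM // !dco_comb //= !simp.
by [].
Qed.

(** On A a trace form may be 1 at ab and ba and 0 at the other words. The maps 1 |-> x0 and x0 |->
    ab compose to right multiplication by ab in one order and to x0 |-> a b x0 in the other, which
    forces the third term. *)
Definition phi_fun (g : G) : k^o :=
  dco 3 (efun g e1).1 + dco 4 (efun g e1).1 + xco 2 (efun g e2).2.

Lemma phi_linear : linear phi_fun.
Proof.
have sumE (c u u' v v' w w' : k) :
    (c * u + u') + (c * v + v') + (c * w + w') = c * (u + v + w) + (u' + v' + w').
  by ring.
move=> c f g; rewrite /phi_fun !efunD !efunZ /= !dcoD !dcoZ xcoD xcoZ.
exact: sumE.
Qed.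
Definition phi : 'Hom(G, k^o) := lin_hom phi_linear.

Lemma phiC f g : phi (f * g) = phi (g * f).
Proof.
rewrite !lin_homE /phi_fun !efunM !(efun_gen _ (efun _ _)) /=.
have [m0 m1 m2 [m4 m6 v1]] := efun_e2 f; have [m0' m1' m2' [m4' m6' v1']] := efun_e2 g.
rewrite !dcoD !xcoD !dcoM // !xco_act !dco_comb //= m0 m1 m2 m4 m0' m1' m2' m4' v1 v1'.
rewrite !(mulr0, mul0r, addr0, add0r).
ring.
Qed.

Let s := a * b + b * a.

Let sE : s = word_comb a b 0 0 0 1 1 0 0 0.
Proof. by rewrite word_combE !scale0r !scale1r !addr0 !add0r. Qed.

Let sC t : s * t = t * s.
Proof.
apply: (dco_ext char2 presA) => -[|[|[|[|[|[|[|[|//]]]]]]]] _;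
  rewrite !dcoM // sE !dco_comb //=;
  by rewrite ?(mulr0, mul0r, mulr1, mul1r, addr0, add0r) // addrC.
Qed.

Fact sact_linear : linear (fun y : AX => lact s y).
Proof. exact: lact_linearr. Qed.
Definition sigma : G := endo sact_linear.

Lemma sigmaE y : efun sigma y = lact s y.
Proof. by apply: (endoE sact_linear) => t z; rewrite -!lactM sC. Qed.

Lemma sigmaC g : sigma * g = g * sigma.
Proof. by apply: efun_inj => y; rewrite !efunM !sigmaE efun_act. Qed.

Lemma sigma_sq : sigma * sigma = 0.
Proof.
apply: efun_inj => y; rewrite efunM !sigmaE efun0 -lactM.
suff -> : s * s = 0 by rewrite lact0l.
apply: (dco_ext char2 presA) => -[|[|[|[|[|[|[|[|//]]]]]]]] _;
  rewrite !dcoM // dco0 sE !dco_comb //=;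
  by rewrite ?(mulr0, mul0r, mulr1, mul1r, addr0, add0r) ?xx.
Qed.

Fact proj_linear : linear (fun y : AX => (0, y.2) : AX).
Proof. by move=> c y z; congr (_, _); rewrite /= scaler0 addr0. Qed.
Definition eps : G := endo proj_linear.

Lemma epsE y : efun eps y = (0, y.2).
Proof.
by apply: (endoE proj_linear) => t z; congr (_, _); rewrite /= mulr0.
Qed.

(** The embedding of X onto the left ideal A ab, with x0 |-> ab, b x0 |-> bab and a b x0 |->
    abab. *)
Definition theta_fun (y : AX) : AX :=
  (word_comb a b 0 0 0 (xco 0 y.2) 0 0 (xco 1 y.2) (xco 2 y.2), 0).
Fact theta_linear : linear theta_fun.
Proof.
move=> c y z; congr (_, _); last by rewrite /= scaler0 addr0.
by rewrite /= !xcoD !xcoZ word_combZ word_combD !mulr0 !addr0.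
Qed.
Definition theta : G := endo theta_linear.

Lemma thetaE y : efun theta y = theta_fun y.
Proof.
apply: (endoE theta_linear) => t z; congr (_, _); last by rewrite /= lact0r.
apply: (dco_ext char2 presA) => -[|[|[|[|[|[|[|[|//]]]]]]]] _;
  rewrite /= dcoM // !dco_comb //= ?xco_act;
  by rewrite ?(mulr0, mul0r, addr0, add0r).
Qed.

Lemma xcoE x : x = xco 0 x *: x0 + xco 1 x *: lact b x0 + xco 2 x *: lact a (lact b x0).
Proof.
have [_ _ _ sp] := uniX; have [c0 [c1 [c2 ->]]] := sp x.
by rewrite !xco_comb.
Qed.

Lemma lact_s_x0 : lact s x0 = lact a (lact b x0).
Proof.
by have [ax0 _ _ _] := uniX; rewrite lactDl !lactM ax0 lact0r addr0.
Qed.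

Lemma AX_eq (u v : AX) : u.1 = v.1 -> u.2 = v.2 -> u = v.
Proof. by case: u v => ? ? [? ?] /= -> ->. Qed.

(* The coordinates of Hom(A (+) X, X) = G eps and of Hom(X, A (+) X) = eps G. *)
Definition lco (i : nat) (g : G) : k :=
  [:: xco 0 (efun g e1).2; xco 1 (efun g e1).2; xco 2 (efun g e1).2;
      xco 0 (efun g e2).2; xco 2 (efun g e2).2]`_i.
Definition lgen (i : nat) : G :=
  [:: ev_endo x0; ev_endo (lact b x0); ev_endo (lact a (lact b x0)); eps; sigma * eps]`_i.
Definition rco (i : nat) (g : G) : k :=
  [:: dco 3 (efun g e2).1; dco 5 (efun g e2).1; dco 7 (efun g e2).1;
      xco 0 (efun g e2).2; xco 2 (efun g e2).2]`_i.
Definition rgen (i : nat) : G :=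
  [:: theta; theta * rmul_endo X a; theta * sigma; eps; eps * sigma]`_i.

Lemma lco_linear i : linear (lco i : G -> k^o).
Proof.
move=> c f g; rewrite /lco !efunD !efunZ /= !xcoD !xcoZ.
by case: i => [|[|[|[|[|i]]]]] //=; rewrite !nth_nil scaler0 addr0.
Qed.

Lemma rco_linear i : linear (rco i : G -> k^o).
Proof.
move=> c f g; rewrite /rco !efunD !efunZ /= !xcoD !xcoZ !dcoD !dcoZ.
by case: i => [|[|[|[|[|i]]]]] //=; rewrite !nth_nil scaler0 addr0.
Qed.

(** Maps A -> X are given by the image of 1, which accounts for three generators. Endomorphisms of X
    are spanned by the identity and s, as the image of x0 has no component at b x0. *)
Lemma mul_eps g : g * eps = \sum_(i < 5) lco i g *: lgen i.
Proof.
have [_ _ _ [_ _ v1]] := efun_e2 g.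
rewrite !big_ord_recl big_ord0 /lco /lgen /=.
apply: efun_gen_ext; rewrite efunM epsE !efunD !efunZ efunM !epsE !ev_endoE sigmaE efun0;
  apply: AX_eq; rewrite /= ?scaler0 ?addr0 //.
  by rewrite !lact1 lact0r !scaler0 !addr0 addrA -xcoE.
by rewrite !lact0l !scaler0 !add0r lact_s_x0 [LHS]xcoE v1 scale0r addr0.
Qed.

(** Maps X -> A send x0 to a combination of ab, aba and abab. These three values come from [theta],
    and from [theta] followed by right multiplication by a or by the action of s. *)
Lemma eps_mul g : eps * g = \sum_(i < 5) rco i g *: rgen i.
Proof.
have [m0 m1 m2 [m4 m6 v1]] := efun_e2 g.
rewrite !big_ord_recl big_ord0 /rco /rgen /=.
apply: efun_gen_ext.
  rewrite !efunM epsE [efun g _]linear0 !efunD !efunZ !efunM !epsE !thetaE efun0.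
  have -> : theta_fun e1 = 0.
    by apply: AX_eq; rewrite //= !xco0 word_combE !scale0r !addr0.
  by rewrite -[(0, e1.2)]/(0 : AX) !linear0 ?(scaler0, addr0).
have th2 : theta_fun e2 = (a * b, 0).
  apply: AX_eq; rewrite //= !xco_x0 //= word_combE !scale0r !addr0 !add0r.
  exact: scale1r.
have eps2 : ((0, e2.2) : AX) = e2 by [].
rewrite !efunM epsE !efunD !efunZ !efunM !epsE !thetaE th2 eps2 !sigmaE rmul_endoE efun0.
apply: AX_eq; rewrite /= ?scaler0 ?addr0 ?add0r.
  rewrite mulr0 !scaler0 !addr0 [LHS](dcoE char2 presA) m0 m1 m2 m4 m6 word_combE.
  rewrite !scale0r !add0r !addr0 -addrA; congr (_ + (_ + _ *: _)).
  by rewrite mulrDl -[in RHS]mulrA [b * a * _]mulrA -[b * a * a]mulrA (aa0 presA) mulr0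
    mul0r addr0 !mulrA.
by rewrite lact0r !scaler0 !add0r lact_s_x0 [LHS]xcoE v1 scale0r addr0.
Qed.

(** The two sums have the same terms: three times the scalar by which g acts on the top of A and
    twice the scalar on the top of X. Their total is an even multiple. *)
Lemma trace_eps g :
  \sum_(i < 5) lco i (g * lgen i) + \sum_(i < 5) rco i (rgen i * g) = 0.
Proof.
have [m0 m1 m2 [m4 m6 v1]] := efun_e2 g.
set p := dco 0 (efun g e1).1; set v0 := xco 0 (efun g e2).2.
have dcs i : (i < 8)%N -> dco i s = nth 0 [:: 0; 0; 0; 1; 1; 0; 0; 0] i.
  by move=> lti; rewrite sE dco_comb.
have simp := (mulr0, mul0r, mulr1, mul1r, addr0, add0r).
have l0 : lco 0 (g * lgen 0) = p.
  by rewrite /lco /= efunM ev_endoE /= xco_act xco_x0 // mulr1.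
have x1E i : (i < 3)%N -> xco i (lact b x0) = (i == 1%N)%:R.
  by move=> lti; rewrite xco_gen // !dco_b //=; case: i lti => [|[|[|]]].
have x2E i : (i < 3)%N -> xco i (lact a (lact b x0)) = (i == 2%N)%:R.
  move=> lti; rewrite -lactM xco_gen // !dcoM // !dco_a // !dco_b //= !simp.
  by case: i lti => [|[|[|]]].
have l1 : lco 1 (g * lgen 1) = p.
  by rewrite /lco /= efunM ev_endoE /= xco_act !x1E // !simp.
have l2 : lco 2 (g * lgen 2) = p.
  by rewrite /lco /= efunM ev_endoE /= xco_act !x2E // !simp.
have l3 : lco 3 (g * lgen 3) = v0 by rewrite /lco /= efunM epsE.
have l4 : lco 4 (g * lgen 4) = v0.
  by rewrite /lco /= !efunM epsE sigmaE /= xco_act !dcs //= !simp.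
have r0 : rco 0 (rgen 0 * g) = p.
  rewrite /rco /= efunM thetaE efun_gen /= /xlift !xco0 !xco_x0 //=.
  rewrite dcoD !dcoM // !dco_comb //=.
  by rewrite ?simp.
have r1 : rco 1 (rgen 1 * g) = p.
  rewrite /rco /= !efunM thetaE rmul_endoE efun_gen /= /xlift !xco0 !xco_x0 //=.
  rewrite dcoD !dcoM // !dco_comb //= !dco_a //=.
  by rewrite ?simp.
have r2 : rco 2 (rgen 2 * g) = p.
  rewrite /rco /= !efunM thetaE sigmaE efun_gen /= lact0r /xlift !xco0 !xco_x0 //=.
  rewrite dcoD !dcoM // !dco_comb //= !dcs //=.
  by rewrite ?simp.
have r3 : rco 3 (rgen 3 * g) = v0 by rewrite /rco /= efunM epsE.
have r4 : rco 4 (rgen 4 * g) = v0.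
  rewrite /rco /= !efunM epsE sigmaE efun_act /= xco_act !dcs //=.
  by rewrite ?simp.
rewrite !big_ord_recl !big_ord0 /= l0 l1 l2 l3 l4 r0 r1 r2 r3 r4.
exact: xx.
Qed.

Local Notation T := (trivext G).

(** The symmetrizing form of the trivial extension. *)
Let lam_fun (t : T) : k^o := t.2 1.
Let lam_linear : linear lam_fun.
Proof. by move=> c t u; rewrite /lam_fun add_lfunE scale_lfunE. Qed.
Let lam : 'Hom(T, k^o) := lin_hom lam_linear.
Let lamC (t u : T) : lam (t * u) = lam (u * t).
Proof.
rewrite !lin_homE /lam_fun /= !add_lfunE !dual_lactE !dual_ractE !mul1r !mulr1.
exact: addrC.
Qed.

Let lfun_linear i : linear (fun t : T => lco i t.1 : k^o).
Proof. by move=> c t u; apply: lco_linear. Qed.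
Let rfun_linear i : linear (fun t : T => t.2 (rgen i) : k^o).
Proof. by move=> c t u; rewrite /= add_lfunE scale_lfunE. Qed.

Let eps_T : T := (eps, 0).

(** T eps is G eps plus the dual of eps G. On the dual part the [rco] span and evaluations at the
    [rgen] are the coordinates, so the trace of (g, h) splits into the two sums of [trace_eps], and
    h drops out. *)
Lemma casimir_trivext_eps (z : T) : casimir z -> lam (z * eps_T) = 0.
Proof.
pose xi (i : 'I_5 + 'I_5) : 'Hom(T, k^o) :=
  match i with inl j => lin_hom (lfun_linear j) | inr j => lin_hom (rfun_linear j) end.
pose F (i : 'I_5 + 'I_5) : T :=
  match i with inl j => (lgen j, 0) | inr j => (0, lin_hom (@rco_linear j)) end.
have epsE' (t : T) : t * eps_T = \sum_i (xi i t : k) *: F i.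
  have fst_sum (I : finType) (H : I -> T) : (\sum_i H i).1 = \sum_i (H i).1.
    by elim/big_rec2: _ => //= i x y _ <-.
  have snd_sum (I : finType) (H : I -> T) : (\sum_i H i).2 = \sum_i (H i).2.
    by elim/big_rec2: _ => //= i x y _ <-.
  rewrite [LHS]surjective_pairing [RHS]surjective_pairing fst_sum snd_sum !big_sumType /=.
  congr (_, _).
    rewrite mul_eps [X in _ = _ + X]big1 ?addr0; last by move=> i _; rewrite scaler0.
    by apply: eq_bigr => i _; rewrite lin_homE.
  rewrite [X in _ = X + _]big1 ?add0r; last by move=> i _; rewrite scaler0.
  apply/lfunP => h; rewrite add_lfunE dual_lactE dual_ractE lfunE add0r.
  rewrite sum_lfunE eps_mul linear_sum; apply: eq_bigr => i _.
  rewrite scale_lfunE !lin_homE linearZ /=; exact: mulrC.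
move=> /(casimir_trace lamC epsE')[[g h] ->]; rewrite big_sumType /=.
under eq_bigr => i _ do rewrite lin_homE /=.
under [X in _ + X]eq_bigr => i _ do
  rewrite lin_homE /= add_lfunE dual_lactE dual_ractE lin_homE mul0r linear0 addr0.
exact: trace_eps.
Qed.

Lemma uniserial_stable_center : exists x y : center T,
  [/\ x * x = 0, y * y = 0 & ~ casimir (vsval (x * y))].
Proof.
have z1 g h : (0 : 'Hom(G, k^o)) (g * h) = (0 : 'Hom(G, k^o)) (h * g) by rewrite !lfunE.
have z2 (g : G) : 0 * g = g * 0 by rewrite mul0r mulr0.
have [x xE] := trivext_central_ex sigmaC z1; have [y yE] := trivext_central_ex z2 phiC.
exists x, y; split.
- apply: val_inj; rewrite /= xE; congr (_, _); first exact: sigma_sq.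
  by apply/lfunP => g; rewrite /= add_lfunE dual_lactE dual_ractE !lfunE addr0.
- apply: val_inj; rewrite /= yE; congr (_, _); first exact: mul0r.
  by apply/lfunP => g; rewrite /= add_lfunE dual_lactE dual_ractE mulr0 mul0r linear0 addr0 lfunE.
(* What remains is the value of phi at x0 |-> s x0 = a b x0, whose last coordinate is 1. *)
move=> /casimir_trivext_eps; rewrite /= xE yE lin_homE /lam_fun /= add_lfunE dual_lactE.
rewrite dual_ractE add_lfunE dual_lactE dual_ractE [X in X + _]lfunE add0r.
rewrite [X in _ + X]lfunE addr0 mulr1 lin_homE /phi_fun !efunM !epsE !sigmaE /=.
rewrite mulr0 dco0 lact_s_x0 -lactM xco_gen //= dco0 !add0r.
rewrite dcoM // !dco_a // !dco_b //= !(mulr0, mul0r, mulr1, addr0, add0r).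
by move/eqP; rewrite oner_eq0.
Qed.

End UniserialCase.

(** * The summand X and the theorem *)

Lemma dsum_summand (k : fieldType) (A : falgType k) (R X Y : lmodule A) :
  lmod_iso R (dsum_lmodule X Y) ->
  exists (pi : 'Hom(R, X)) (iota : 'Hom(X, R)),
    [/\ lmod_hom pi, lmod_hom iota & forall x, pi (iota x) = x].
Proof.
move=> [f homf [f' fK f'K]].
have pi_lin : linear (fun r => (f r).1 : X) by move=> c u v; rewrite linearP.
have iota_lin : linear (fun x : X => f' ((x, 0) : dsum_lmodule X Y)).
  move=> c u v; apply: (can_inj fK); rewrite linearP /= !f'K.
  by congr (_, _); rewrite /= scaler0 addr0.
exists (lin_hom pi_lin), (lin_hom iota_lin); split=> [t r | t x | x].
- by rewrite !lin_homE homf.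
- rewrite !lin_homE; apply: (can_inj fK); rewrite homf !f'K.
  by congr (_, _); rewrite /= lact0r.
by rewrite !lin_homE f'K.
Qed.

Theorem proposition3p1 (k : closedFieldType) (hchar : 2%N \in [pchar k])
    (A : falgType k) (alpha beta : A) (hA : D8_presentation alpha beta)
    (S : lmodule A) (hS : simple_module S)
    (X : lmodule A) (hXindec : indecomposable_module X)
    (hXsummand : exists Y : lmodule A,
       lmod_iso (rad_mod_rad4 A) (dsum_lmodule X Y)) :
  let Lambda : falgType k := reg_dsum_endop S in
  let Gamma : falgType k := reg_dsum_endop X in
  ~ stable_centers_isomorphic (trivext Lambda) (trivext Gamma) /\
  ~ stably_equivalent_of_Morita_type (trivext Lambda) (trivext Gamma).
Proof.
move=> Lambda Gamma.
have [y0 [nzy0 ay0 by0] lineS] := simple_module_line hchar hA hS.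
have orthL := simple_stable_center hchar hA nzy0 ay0 by0 lineS.
have [x [y [xx0 yy0 xyN]]] : exists x y : center (trivext Gamma),
    [/\ x * x = 0, y * y = 0 & ~ casimir (vsval (x * y))].
  have [Y /dsum_summand[pi [iota [hpi hiota piK]]]] := hXsummand.
  have [r1 [r2 bi]] := rad_biuniserial hchar hA.
  (* The two possible shapes of X are exchanged by swapping the generators, under which the
     presentation is symmetric. *)
  have [[x0 uni] | [x0 uni]] := uniserial_summand hpi hiota piK hchar hA bi hXindec.
    exact: (uniserial_stable_center hchar hA uni).
  exact: (uniserial_stable_center hchar (D8_presentation_sym hA) uni).
split=> H; apply: xyN.
  exact/proj_center_casimir/(stable_center_iso_orthogonal orthL H).
exact: (stable_equivalence_orthogonal orthL H).
Qed.
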